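(* Let $T:E\to F$ be an order bounded operator between Banach lattices. The following are equivalent: (1) $T$ is an almost weak Dunford-Pettis operator. (2) For every relatively weakly compact $A\subset E$, $T(\mathrm{sol}(A))$ is an almost Dunford-Pettis set in $F$. (3) For every relatively weakly compact $A\subset E$, $T(A)$ is an almost Dunford-Pettis set in $F$. (4) For every relatively weakly compact $B\subset F'$, $T'(\mathrm{sol}(B))$ is an almost (L)-set in $E'$. (5) For every relatively weakly compact $B\subset F'$, $T'(B)$ is an almost (L)-set in $E'$.
   Context: $\mathrm{sol}(A)=\{x:|x|\le|a|\text{ for some }a\in A\}$ is the solid hull of $A$. A sequence is disjoint if $|x_n|\wedge|x_m|=0$ for $n\neq m$. $T$ is almost weak Dunford-Pettis if $f_n(Tx_n)\to0$ whenever $(x_n)\subset E$ and $(f_n)\subset F'$ are disjoint weakly null sequences. A norm bounded set $A\subset F$ is an almost Dunford-Pettis set if every disjoint weakly null sequence $(f_n)\subset F'$ satisfies $\sup_{y\in A}|f_n(y)|\to0$. A norm bounded set $B\subset E'$ is an almost (L)-set if every disjoint weakly null sequence $(x_n)\subset E$ satisfies $\sup_{g\in B}|g(x_n)|\to0$. $T'$ denotes the adjoint of $T$. *)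

(* Defs.v *)
From HB Require Import structures.
From mathcomp Require Import all_boot all_order all_algebra.
From mathcomp Require Import all_classical all_reals all_analysis.

Set Implicit Arguments.
Unset Strict Implicit.
Unset Printing Implicit Defensive.

Import Order.TTheory GRing.Theory Num.Theory.
Import numFieldNormedType.Exports.
Local Open Scope classical_set_scope.
Local Open Scope ring_scope.

Record BanachLattice (R : realType) (E : completeNormedModType R) := {
  ble : E -> E -> Prop;
  bjoin : E -> E -> E;
  bmeet : E -> E -> E;
  ble_refl : forall x, ble x x;
  ble_trans : forall x y z, ble x y -> ble y z -> ble x z;
  ble_anti : forall x y, ble x y -> ble y x -> x = y;
  ble_add : forall x y z, ble x y -> ble (x + z) (y + z);
  ble_scale : forall (a : R) x y, 0 <= a -> ble x y -> ble (a *: x) (a *: y);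
  bjoin_ubl : forall x y, ble x (bjoin x y);
  bjoin_ubr : forall x y, ble y (bjoin x y);
  bjoin_lub : forall x y z, ble x z -> ble y z -> ble (bjoin x y) z;
  bmeet_lbl : forall x y, ble (bmeet x y) x;
  bmeet_lbr : forall x y, ble (bmeet x y) y;
  bmeet_glb : forall x y z, ble z x -> ble z y -> ble z (bmeet x y);
  bnorm_mono : forall x y, ble (bjoin x (- x)) (bjoin y (- y)) -> `|x| <= `|y|
}.

Section BL.
Variables (R : realType) (E : completeNormedModType R) (L : BanachLattice E).

Definition babs (x : E) : E := bjoin L x (- x).

Definition sol (A : set E) : set E :=
  [set x | exists2 a, A a & ble L (babs x) (babs a)].

Definition disjoint_seq (x : nat -> E) : Prop :=
  forall n m : nat, n <> m -> bmeet L (babs (x n)) (babs (x m)) = 0.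

Definition order_bounded (F : completeNormedModType R) (LF : BanachLattice F)
    (T : E -> F) : Prop :=
  forall a b : E, exists c d : F, forall z : E,
    ble L a z -> ble L z b -> ble LF c (T z) /\ ble LF (T z) d.

End BL.

Section Duals.
Variables (R : realType) (E : normedModType R).

Definition is_dual (f : E -> R) : Prop :=
  (forall (a : R) (x y : E), f (a *: x + y) = a * f x + f y) /\ continuous f.

Definition dnorm (f : E -> R) : R := sup [set `|f x| | x in [set x : E | `|x| <= 1]].

Definition is_bidual (phi : (E -> R) -> R) : Prop :=
  (forall (a : R) (f g : E -> R), is_dual f -> is_dual g ->
     phi (fun x => a * f x + g x) = a * phi f + phi g) /\
  exists C : R, forall f, is_dual f -> `|phi f| <= C * dnorm f.

Definition Dual := {f : E -> R | `[< is_dual f >]}.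
Definition Bidual := {phi : (E -> R) -> R | `[< is_bidual phi >]}.

Definition wev (x : E) : {ptws Dual -> R} := fun f => proj1_sig f x.
Definition weakE := initial_topology wev.

Definition wev' (f : Dual) : {ptws Bidual -> R} := fun phi => proj1_sig phi (proj1_sig f).
Definition weakE' := initial_topology wev'.

Definition rel_weakly_compact (A : set E) : Prop :=
  compact (closure (A : set weakE)).

Definition rel_weakly_compact' (B : set (E -> R)) : Prop :=
  B `<=` is_dual /\
  compact (closure ([set f : Dual | B (proj1_sig f)] : set weakE')).

Definition weakly_null (x : nat -> E) : Prop :=
  forall f : E -> R, is_dual f -> (fun n => f (x n)) @ \oo --> (0 : R).

Definition weakly_null' (f : nat -> (E -> R)) : Prop :=
  (forall n, is_dual (f n)) /\
  forall phi, is_bidual phi -> (fun n => phi (f n)) @ \oo --> (0 : R).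

Definition norm_bounded (A : set E) : Prop :=
  exists M : R, forall y, A y -> `|y| <= M.

Definition norm_bounded' (B : set (E -> R)) : Prop :=
  exists M : R, forall g, B g -> dnorm g <= M.

End Duals.

(* Lattice structure of the dual E' (Riesz-Kantorovich formulas)            *)

Section DualLattice.
Variables (R : realType) (E : completeNormedModType R) (L : BanachLattice E).

(* |f|(x) = sup { |f z| : |z| <= x }   for x >= 0 *)
Definition dabs (f : E -> R) (x : E) : R :=
  sup [set `|f z| | z in [set z : E | ble L (babs L z) x]].

(* f, g \in E' are disjoint : (|f| /\ |g|)(x) = inf {|f|(y) + |g|(x - y) : 0 <= y <= x} = 0 *)
Definition ddisjoint (f g : E -> R) : Prop :=
  forall x : E, ble L 0 x ->
    inf [set dabs f y + dabs g (x - y) | y in [set y : E | ble L 0 y /\ ble L y x]] = 0.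

Definition ddisjoint_seq (f : nat -> (E -> R)) : Prop :=
  forall n m : nat, n <> m -> ddisjoint (f n) (f m).

Definition dsol (B : set (E -> R)) : set (E -> R) :=
  [set f | is_dual f /\ exists2 g, B g &
     forall x : E, ble L 0 x -> dabs f x <= dabs g x].

Definition almost_DP_set (A : set E) : Prop :=
  norm_bounded A /\
  forall f : nat -> (E -> R), ddisjoint_seq f -> weakly_null' f ->
    (fun n => sup [set `|f n y| | y in A]) @ \oo --> (0 : R).

Definition almost_L_set (B : set (E -> R)) : Prop :=
  B `<=` @is_dual R E /\ norm_bounded' B /\
  forall x : nat -> E, disjoint_seq L x -> weakly_null x ->
    (fun n => sup [set `|g (x n)| | g in B]) @ \oo --> (0 : R).

End DualLattice.

Section Operators.
Variables (R : realType) (E F : completeNormedModType R)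
  (LE : BanachLattice E) (LF : BanachLattice F).

Definition almost_weak_DP (T : E -> F) : Prop :=
  forall (x : nat -> E) (f : nat -> (F -> R)),
    disjoint_seq LE x -> weakly_null x ->
    ddisjoint_seq LF f -> weakly_null' f ->
    (fun n => f n (T (x n))) @ \oo --> (0 : R).

Definition adjoint (T : E -> F) (g : F -> R) : E -> R := fun x => g (T x).

End Operators.

(* Main.v *)
(* Both (1) => (2) and (1) => (4) are the same statement about the pairing
   b(x, f) = f (T x), applied once to E and once to the Banach lattice F';
   everything is therefore proved for an abstract normed Riesz space, of which
   E and F' are instances.

   If (b_n) are linear forms tending to 0 uniformly on order intervals and
   |b_n x_n| > e for some x_n >= 0 in the solid hull of a relatively weakly
   compact set A, then truncating x_{n_k} against
   4^k \sum_(j < k) x_{n_j} + 2^-k u, with u >= 2^-j x_{n_j} for all j, yields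
   disjoint z_k with 0 <= z_k <= x_{n_k} and |b_{n_k} z_k| >= e / 2.  Disjoint
   sequences in the solid hull of A are weakly null: for a form f, the
   restrictions of |f| to the disjoint ideals generated by the z_k dominate, by
   Hahn-Banach, linear forms g_k with \sum_k |g_k| <= |f| and
   g_k(a_k) >= |f(z_k)|, and Schur's gliding hump shows g_k(a_k) -> 0 along A.
   This contradicts (1).

   Uniform smallness on order intervals again comes from Hahn-Banach: if (x_n)
   is disjoint and weakly null and r_n >= 0 satisfies
   \sum c_n r_n <= q(\sum c_n x_n) for a lattice seminorm q, then some
   continuous form takes the value r_n at x_n, so r_n -> 0.  In F' one takes
   r_n = |f_n|(y); in E, r_n = f(|T x_n|) and
   q(x) = inf {f y : T z <= y whenever |z| <= |x|}, which is finite because T is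
   order bounded. *)
Require Import Defs.
From HB Require Import structures.
From mathcomp Require Import all_boot all_order all_algebra.
From mathcomp Require Import all_classical all_reals all_analysis.
From mathcomp Require Import lra.

Set Implicit Arguments.
Unset Strict Implicit.
Unset Printing Implicit Defensive.

Import Order.TTheory GRing.Theory Num.Theory.
Import numFieldNormedType.Exports.
Local Open Scope classical_set_scope.
Local Open Scope ring_scope.

(** * Linear forms and the Hahn-Banach theorem *)

Section LinearForms.
Variables (R : realType) (V : lmodType R).

(** Unbundled, in the exact shape of the algebraic half of [is_dual]. *)
Definition linform (f : V -> R) : Prop :=
  forall (a : R) (x y : V), f (a *: x + y) = a * f x + f y.

Lemma linform0 (f : V -> R) : linform f -> f 0 = 0.
Proof. by move=> lf; have := lf 1 0 0; rewrite scale1r addr0 mul1r; lra. Qed.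

Lemma linformD (f : V -> R) x y : linform f -> f (x + y) = f x + f y.
Proof. by move=> lf; have := lf 1 x y; rewrite scale1r mul1r. Qed.

Lemma linformZ (f : V -> R) a x : linform f -> f (a *: x) = a * f x.
Proof. by move=> lf; have := lf a x 0; rewrite (linform0 lf) !addr0. Qed.

Lemma linformN (f : V -> R) x : linform f -> f (- x) = - f x.
Proof. by move=> lf; rewrite -scaleN1r (linformZ _ _ lf) mulN1r. Qed.

Lemma linformB (f : V -> R) x y : linform f -> f (x - y) = f x - f y.
Proof. by move=> lf; rewrite (linformD _ _ lf) (linformN _ lf). Qed.

Lemma linform_sum (f : V -> R) (I : Type) (s : seq I) (x : I -> V) :
  linform f -> f (\sum_(i <- s) x i) = \sum_(i <- s) f (x i).
Proof.
move=> lf; elim: s => [|i s IH]; first by rewrite !big_nil (linform0 lf).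
by rewrite !big_cons (linformD _ _ lf) IH.
Qed.

Definition seminorm (q : V -> R) : Prop :=
  (forall x y, q (x + y) <= q x + q y) /\
  (forall (a : R) x, q (a *: x) = `|a| * q x).

Lemma seminorm0 q : seminorm q -> q 0 = 0.
Proof. by move=> [_ qZ]; have := qZ 0 0; rewrite scaler0 normr0 mul0r. Qed.

Lemma seminormN q x : seminorm q -> q (- x) = q x.
Proof. by move=> [_ qZ]; rewrite -scaleN1r qZ normrN1 mul1r. Qed.

Lemma seminorm_ge0 q x : seminorm q -> 0 <= q x.
Proof.
move=> sq; have := sq.1 x (- x); rewrite subrr (seminorm0 sq) (seminormN _ sq).
lra.
Qed.

Lemma linform_abs_le (f q : V -> R) x :
  linform f -> seminorm q -> (forall y, f y <= q y) -> `|f x| <= q x.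
Proof.
move=> lf sq fq; rewrite ler_norml fq andbT lerNl -(linformN _ lf).
by rewrite -(seminormN x sq).
Qed.

(** A partially defined linear form is coded by its graph. Single-valuedness comes from domination:
    two values over one point differ by a value over [0], and [q 0 = 0]. *)
Definition linear_graph (G : set (V * R)) : Prop :=
  forall (a : R) u v, G u -> G v -> G (a *: u.1 + v.1, a * u.2 + v.2).

Definition dominated_graph (q : V -> R) (G : set (V * R)) : Prop :=
  forall u, G u -> u.2 <= q u.1.

(** The one-dimensional Hahn-Banach step. The value [c] at [x0] must lie between every
    [u.2 - q (u.1 - x0)] and every [q (z.1 + x0) - z.2]; subadditivity orders the two families, so
    the supremum of the first one serves. *)
Lemma extend_dominated_graph (q : V -> R) (G : set (V * R)) (x0 : V) :
  seminorm q -> G (0, 0) -> linear_graph G -> dominated_graph q G ->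
  exists B, [/\ G `<=` B, linear_graph B, dominated_graph q B
    & exists c, B (x0, c)].
Proof.
move=> sq G0 lG dG.
have GZ a u : G u -> G (a *: u.1, a * u.2).
  by move=> Gu; have := lG a _ _ Gu G0; rewrite /= !addr0.
pose S := [set u.2 - q (u.1 - x0) | u in G].
have Sub z : G z -> ubound S (q (z.1 + x0) - z.2).
  move=> Gz _ [u Gu <-]; have := dG _ (lG 1 _ _ Gu Gz).
  rewrite /= scale1r mul1r => h.
  have := sq.1 (u.1 - x0) (z.1 + x0).
  by rewrite addrACA addNr addr0 => h2; lra.
have S0 : S !=set0 by exists (0 - q (0 - x0)); exists (0, 0).
have bS : has_ubound S by exists (q (0 + x0) - 0); exact: (Sub _ G0).
pose c := sup S.
exists [set w | exists u t, G u /\ w = (u.1 + t *: x0, u.2 + t * c)]; split.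
- by move=> [y r] Gyr; exists (y, r), 0; rewrite scale0r mul0r !addr0.
- move=> a _ _ [u [t [Gu ->]]] [v [s [Gv ->]]] /=.
  exists (a *: u.1 + v.1, a * u.2 + v.2), (a * t + s); split; first exact: lG.
  by congr pair => /=; [rewrite scalerDr scalerDl scalerA addrACA|lra].
- move=> _ [u [t [Gu ->]]] /=.
  (* Dividing by [|t|] reduces to the coefficient [-1] or [1] of [x0], hence to one of the two
     bounds on [c]. *)
  have [t0|t0|->] := ltgtP t 0; last by rewrite mul0r scale0r !addr0 dG.
  + have : (- t)^-1 * u.2 - q ((- t)^-1 *: u.1 - x0) <= c.
      by apply: ub_le_sup => //; exists ((- t)^-1 *: u.1, (- t)^-1 * u.2) => //; exact: GZ.
    move=> h; have t1 : 0 < - t by lra.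
    have := ler_wpM2l (ltW t1) h.
    rewrite mulrBr mulrA mulfV ?gt_eqF// mul1r.
    rewrite -[X in X * q _](ger0_norm (ltW t1)) -sq.2 scalerBr scalerA.
    rewrite mulfV ?gt_eqF// scale1r scaleNr opprK; lra.
  + have : c <= q (t^-1 *: u.1 + x0) - t^-1 * u.2.
      by apply: ge_sup => //; exact: (Sub _ (GZ t^-1 _ Gu)).
    move=> h; have := ler_wpM2l (ltW t0) h.
    rewrite mulrBr mulrA mulfV ?gt_eqF// mul1r.
    rewrite -[X in X * q _](ger0_norm (ltW t0)) -sq.2 scalerDr scalerA.
    by rewrite mulfV ?gt_eqF// scale1r; lra.
- by exists c, (0, 0), 1; rewrite /= !add0r scale1r mul1r.
Qed.

Theorem hahn_banach (q : V -> R) (P : set (V * R)) :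
  seminorm q -> P (0, 0) -> linear_graph P -> dominated_graph q P ->
  exists g, [/\ linform g, forall x, g x <= q x & forall u, P u -> g u.1 = u.2].
Proof.
move=> sq P0 lP dP.
(* Zorn's lemma also meets the empty chain, whose union is empty; joining [P] to every candidate
   keeps that union admissible. *)
pose Q (X : set (V * R)) := linear_graph (P `|` X) /\ dominated_graph q (P `|` X).
have [F FQ totF|A [[lA dA] maxA]] := @Zorn_bigcup _ Q.
  split; last first.
    move=> u [Pu|[X FX Xu]]; first exact: dP.
    by apply: (FQ X FX).2; right.
  move=> a u v [Pu|[X FX Xu]] [Pv|[Y FY Yv]].
  - by left; exact: lP.
  - have [] := (FQ Y FY).1 a u v (or_introl Pu) (or_intror Yv); first by left.
    by right; exists Y.
  - have [] := (FQ X FX).1 a u v (or_intror Xu) (or_introl Pv); first by left.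
    by right; exists X.
  - have [XY|YX] := totF _ _ FX FY.
    + have [] := (FQ Y FY).1 a u v (or_intror (XY _ Xu)) (or_intror Yv).
        by left.
      by right; exists Y.
    + have [] := (FQ X FX).1 a u v (or_intror Xu) (or_intror (YX _ Yv)).
        by left.
      by right; exists X.
(* A point outside the domain would allow a proper extension, against maximality. *)
have tot x : exists r, (P `|` A) (x, r).
  apply: contrapT => nx.
  have [B [GB lB dB [c Bc]]] :=
    extend_dominated_graph x sq (or_introl P0 : (P `|` A) (0, 0)) lA dA.
  have PB : P `|` B = B.
    by apply: setUidr => u Pu; apply: GB; left.
  apply: (maxA B); last by rewrite /Q PB.
  split=> [u Au|BA]; first by apply: GB; right.
  by apply: nx; exists c; right; exact: BA.
have [g gP] := choice tot.
have uniqG x r : (P `|` A) (x, r) -> g x = r.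
  move=> xr; have h1 := dA _ (lA (-1) _ _ xr (gP x)).
  have h2 := dA _ (lA (-1) _ _ (gP x) xr).
  move: h1 h2; rewrite /= scaleN1r addNr (seminorm0 sq); lra.
exists g; split=> [a x y|x|[x r] Pu /=].
- by apply: uniqG; exact: (lA _ _ _ (gP x) (gP y)).
- exact: (dA _ (gP x)).
- by apply: uniqG; left.
Qed.

Lemma hahn_banach1 (q : V -> R) (a : V) : seminorm q ->
  exists g, [/\ linform g, forall x, `|g x| <= q x & g a = q a].
Proof.
move=> sq.
have [||||g [lg gq gP]] := @hahn_banach q [set u | exists c, u = (c *: a, c * q a)].
- exact: sq.
- by exists 0; rewrite scale0r mul0r.
- move=> b _ _ [c ->] [d ->] /=; exists (b * c + d).
  by rewrite scalerDl scalerA; congr pair; lra.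
- move=> _ [c ->] /=; rewrite sq.2; apply: ler_wpM2r; last exact: ler_norm.
  exact: seminorm_ge0.
exists g; split=> // [x|]; first exact: linform_abs_le.
by apply: (gP (a, q a)); exists 1; rewrite scale1r mul1r.
Qed.

(** The hypothesis says that [\sum c i *: x i |-> \sum c i * r i] is dominated by [q] on the span of
    [x]; used with both signs of [c], it also makes this map well defined. *)
Lemma hahn_banach_seq (q : V -> R) (x : nat -> V) (r : nat -> R) :
  seminorm q ->
  (forall n (c : nat -> R),
    \sum_(0 <= i < n) c i * r i <= q (\sum_(0 <= i < n) c i *: x i)) ->
  exists g, [/\ linform g, forall y, `|g y| <= q y & forall n, g (x n) = r n].
Proof.
move=> sq qx.
(* Coefficients vanish from [n] on, so that two combinations can be rewritten over a common range
   before being added. *)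
pose P := [set u : V * R | exists n (c : nat -> R), (forall i, (n <= i)%N -> c i = 0) /\
   u = (\sum_(0 <= i < n) c i *: x i, \sum_(0 <= i < n) c i * r i)].
have widen (U : nmodType) n m (h : nat -> U) :
    (n <= m)%N -> (forall i, (n <= i)%N -> h i = 0) ->
    \sum_(0 <= i < n) h i = \sum_(0 <= i < m) h i.
  move=> nm h0; rewrite [in RHS](@big_cat_nat _ _ _ n)//=.
  rewrite [X in _ = _ + X]big_nat_cond [X in _ = _ + X]big1 ?addr0// => i /andP[/andP[ni _] _].
  exact: h0.
have [||||g [lg gq gP]] := @hahn_banach q P.
- exact: sq.
- by exists 0%N, (fun=> 0); rewrite !big_geq.
- move=> a _ _ [n [c [c0 ->]]] [m [d [d0 ->]]] /=.
  exists (maxn n m), (fun i => a * c i + d i); split.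
    by move=> i; rewrite geq_max => /andP[/c0 -> /d0 ->]; rewrite mulr0 addr0.
  have [nk mk] := (leq_maxl n m, leq_maxr n m).
  rewrite (widen _ _ _ _ nk); last by move=> i /c0 ->; rewrite scale0r.
  rewrite (widen _ _ _ _ mk); last by move=> i /d0 ->; rewrite scale0r.
  rewrite (widen _ _ _ (fun i => c i * r i) nk); last by move=> i /c0 ->; rewrite mul0r.
  rewrite (widen _ _ _ (fun i => d i * r i) mk); last by move=> i /d0 ->; rewrite mul0r.
  congr pair.
    rewrite scaler_sumr -big_split /=; apply: eq_bigr => i _.
    by rewrite scalerDl scalerA.
  rewrite mulr_sumr -big_split /=; apply: eq_bigr => i _; lra.
- by move=> _ [n [c [_ ->]]] /=; exact: qx.
exists g; split=> // [y|n]; first exact: linform_abs_le.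
apply: (gP (x n, r n)); exists n.+1, (fun i => (i == n)%:R); split.
  by move=> i ni; rewrite gtn_eqF.
rewrite !big_nat_recr//= eqxx scale1r mul1r; congr pair.
  rewrite big_nat_cond big1 ?add0r// => i /andP[/andP[_ ilt] _].
  by rewrite ltn_eqF// scale0r.
rewrite big_nat_cond big1 ?add0r// => i /andP[/andP[_ ilt] _].
by rewrite ltn_eqF// mul0r.
Qed.

End LinearForms.
(** * Normed Riesz spaces *)

Record rieszSpace (R : realType) (V : lmodType R) := RieszSpace {
  rle : V -> V -> Prop;
  rjoin : V -> V -> V;
  rnorm : V -> R;
  rle_refl : forall x, rle x x;
  rle_trans : forall y x z, rle x y -> rle y z -> rle x z;
  rle_anti : forall x y, rle x y -> rle y x -> x = y;
  rle_add : forall z x y, rle x y -> rle (x + z) (y + z);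
  rle_scale : forall (a : R) x y, 0 <= a -> rle x y -> rle (a *: x) (a *: y);
  rjoin_ubl : forall x y, rle x (rjoin x y);
  rjoin_ubr : forall x y, rle y (rjoin x y);
  rjoin_lub : forall x y z, rle x z -> rle y z -> rle (rjoin x y) z;
  rnorm_seminorm : seminorm rnorm;
  rnorm_mono : forall x y,
    rle (rjoin x (- x)) (rjoin y (- y)) -> rnorm x <= rnorm y;
  (* What remains of norm completeness: a common order bound of [2^-n u_n]. *)
  rnorm_sigma : forall (u : nat -> V) (M : R),
    (forall n, rle 0 (u n)) -> (forall n, rnorm (u n) <= M) ->
    exists v, forall n, rle (2^-1 ^+ n *: u n) v
}.

Section RieszTheory.
Variables (R : realType) (V : lmodType R) (S : rieszSpace V).
Local Notation "x <=: y" := (rle S x y) (at level 70).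
Local Notation N := (rnorm S).

Definition rabs (x : V) : V := rjoin S x (- x).
Definition rpos (x : V) : V := rjoin S x 0.

(** [rieszSpace] records no meet; for positive [a] and [b] this says that their infimum is [0]. *)
Definition rdisj (a b : V) : Prop := forall z, z <=: a -> z <=: b -> z <=: 0.

Lemma half_double (x : V) : 2^-1 *: (x + x) = x :> V.
Proof.
rewrite -{1 2}[x]scale1r -scalerDl scalerA.
have -> : 2^-1 * (1 + 1) = 1 :> R by lra.
by rewrite !scale1r.
Qed.

Lemma rle_addl z x y : x <=: y -> z + x <=: z + y.
Proof. by rewrite ![z + _]addrC; exact: rle_add. Qed.

Lemma rleD x y x' y' : x <=: y -> x' <=: y' -> x + x' <=: y + y'.
Proof. by move=> h h'; apply: (rle_trans (rle_add x' h)); exact: rle_addl. Qed.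

Lemma rle_subl x y z : x - y <=: z <-> x <=: z + y.
Proof.
split=> [/(rle_add y)|/(rle_add (- y))]; first by rewrite subrK.
by rewrite addrK.
Qed.

Lemma rle_subr x y z : x <=: y - z <-> x + z <=: y.
Proof.
split=> [/(rle_add z)|/(rle_add (- z))]; first by rewrite subrK.
by rewrite addrK.
Qed.

Lemma rleN x y : x <=: y -> - y <=: - x.
Proof. by move=> /(rle_add (- x - y)); rewrite addrA subrr sub0r addrCA subrr addr0. Qed.

Lemma rleNl x y : - x <=: y -> - y <=: x.
Proof. by move=> /rleN; rewrite opprK. Qed.

Lemma rsub_ge0 x y : 0 <=: y - x <-> x <=: y.
Proof. by rewrite rle_subr add0r. Qed.

Lemma rge0D x y : 0 <=: x -> 0 <=: y -> 0 <=: x + y.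
Proof. by move=> x0 y0; have := rleD x0 y0; rewrite addr0. Qed.

Lemma rle_addr x y : 0 <=: y -> x <=: x + y.
Proof. by move=> /(rle_addl x); rewrite addr0. Qed.

Lemma rle_addrl x y : 0 <=: y -> x <=: y + x.
Proof. by rewrite addrC; exact: rle_addr. Qed.

Lemma rge0Z a x : 0 <= a -> 0 <=: x -> 0 <=: a *: x.
Proof. by move=> a0 /(rle_scale a0); rewrite scaler0. Qed.

Lemma rle_scaleW a b x : a <= b -> 0 <=: x -> a *: x <=: b *: x.
Proof.
move=> ab x0; apply/rsub_ge0; rewrite -scalerBl; apply: rge0Z => //.
by rewrite subr_ge0.
Qed.

Lemma rle_scaleK a x y : 0 < a -> a *: x <=: a *: y -> x <=: y.
Proof.
move=> a0 h; have a1 : 0 <= a^-1 by rewrite invr_ge0 ltW.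
by have := rle_scale a1 h; rewrite !scalerA mulVf ?gt_eqF// !scale1r.
Qed.

Lemma rge0_sum (I : eqType) (s : seq I) (x : I -> V) :
  (forall i, i \in s -> 0 <=: x i) -> 0 <=: \sum_(i <- s) x i.
Proof.
elim: s => [|i s IH] h; first by rewrite big_nil; exact: rle_refl.
rewrite big_cons; apply: rge0D; first by apply: h; rewrite mem_head.
by apply: IH => j js; apply: h; rewrite inE js orbT.
Qed.

Lemma rle_abs x : x <=: rabs x. Proof. exact: rjoin_ubl. Qed.

Lemma rleN_abs x : - x <=: rabs x. Proof. exact: rjoin_ubr. Qed.

Lemma rabs_le x z : x <=: z -> - x <=: z -> rabs x <=: z.
Proof. exact: rjoin_lub. Qed.

Lemma rabs_ge0 x : 0 <=: rabs x.
Proof.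
have h : 0 <=: rabs x + rabs x.
  by rewrite -(subrr x); apply: rleD; [exact: rle_abs|exact: rleN_abs].
apply: (@rle_scaleK 2); first by lra.
by rewrite scaler0 scaler_nat mulr2n.
Qed.

Lemma rabs_pos x : 0 <=: x -> rabs x = x.
Proof.
move=> x0; apply: rle_anti _ (rle_abs x); apply: rabs_le; first exact: rle_refl.
by apply: rle_trans (x0); apply: rleNl; rewrite oppr0.
Qed.

Lemma rabsN x : rabs (- x) = rabs x.
Proof.
have h y : rabs (- y) <=: rabs y.
  by apply: rabs_le; [exact: rleN_abs|rewrite opprK; exact: rle_abs].
by apply: rle_anti (h x) _; have := h (- x); rewrite opprK.
Qed.

Lemma rabs0 : rabs 0 = 0. Proof. exact: (rabs_pos (rle_refl S 0)). Qed.

Lemma rabsD x y : rabs (x + y) <=: rabs x + rabs y.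
Proof.
apply: rabs_le; first by apply: rleD; exact: rle_abs.
by rewrite opprD; apply: rleD; exact: rleN_abs.
Qed.

Lemma rabs_sum (I : Type) (s : seq I) (x : I -> V) :
  rabs (\sum_(i <- s) x i) <=: \sum_(i <- s) rabs (x i).
Proof.
elim: s => [|i s IH]; first by rewrite !big_nil rabs0; exact: rle_refl.
by rewrite !big_cons; apply: (rle_trans (rabsD _ _)); exact: rle_addl.
Qed.

Lemma rabs_sub x y : rabs x - rabs y <=: rabs (x + y).
Proof.
apply/rle_subl; apply: rle_trans (_ : rabs ((x + y) - y) <=: _).
  by rewrite addrK; exact: rle_refl.
by apply: (rle_trans (rabsD _ _)); rewrite rabsN; exact: rle_refl.
Qed.

Lemma rabsZ a x : rabs (a *: x) = `|a| *: rabs x.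
Proof.
have le b y : rabs (b *: y) <=: `|b| *: rabs y.
  have [b0|b0] := leP 0 b.
    rewrite ger0_norm//; apply: rabs_le; rewrite -?scalerN; apply: rle_scale => //.
      exact: rle_abs.
    exact: rleN_abs.
  rewrite ltr0_norm//; have nb : 0 <= - b by lra.
  apply: rabs_le; last by rewrite -scaleNr; apply: rle_scale => //; exact: rle_abs.
  rewrite -[b]opprK scaleNr -scalerN opprK; apply: rle_scale => //.
  exact: rleN_abs.
have [->|a0] := eqVneq a 0; first by rewrite scale0r normr0 scale0r rabs0.
apply: rle_anti (le a x) _.
have := rle_scale (normr_ge0 a) (le a^-1 (a *: x)).
rewrite !scalerA mulVf// scale1r -normrM mulfV// normr1 scale1r.
exact.
Qed.

Lemma rle_pos x : x <=: rpos x. Proof. exact: rjoin_ubl. Qed.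

Lemma rpos_ge0 x : 0 <=: rpos x. Proof. exact: rjoin_ubr. Qed.

Lemma rpos_le x z : x <=: z -> 0 <=: z -> rpos x <=: z.
Proof. exact: rjoin_lub. Qed.

Lemma rpos_mono x y : x <=: y -> rpos x <=: rpos y.
Proof.
move=> xy; apply: rpos_le (rpos_ge0 _); exact: (rle_trans xy (rle_pos y)).
Qed.

Lemma rpos_le_abs x : rpos x <=: rabs x.
Proof. exact: rpos_le (rle_abs x) (rabs_ge0 x). Qed.

Lemma rposB x : rpos x - rpos (- x) = x.
Proof.
have h y : y <=: rpos y - rpos (- y).
  apply/rle_subr; rewrite addrC; apply/rle_subr.
  apply: rpos_le; last by apply/rsub_ge0; exact: rle_pos.
  by apply/rle_subr; rewrite addNr; exact: rpos_ge0.
apply: rle_anti _ (h x).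
by have := rleN (h (- x)); rewrite opprB !opprK.
Qed.

Lemma rposZ a x : 0 <= a -> rpos (a *: x) = a *: rpos x.
Proof.
have le b y : 0 <= b -> rpos (b *: y) <=: b *: rpos y.
  move=> b0; apply: rpos_le; first by apply: rle_scale => //; exact: rle_pos.
  by apply: rge0Z => //; exact: rpos_ge0.
rewrite le_eqVlt => /predU1P[<-|a0].
  by rewrite !scale0r /rpos; exact: rle_anti (rpos_le (rle_refl _ _) (rle_refl _ _)) (rpos_ge0 _).
apply: rle_anti (le _ _ (ltW a0)) _.
have a1 : 0 <= a^-1 by rewrite invr_ge0 ltW.
have := rle_scale (ltW a0) (le _ (a *: x) a1).
by rewrite !scalerA mulVf ?gt_eqF// mulfV ?gt_eqF// !scale1r.
Qed.

(** For the lower bound on [rabs x]: half of [rabs x + x] is above both [x] and [0], hence above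
    [rpos x]. *)
Lemma rabsE x : rabs x = rpos x + rpos (- x).
Proof.
have e : rpos x + rpos (- x) = rpos x + rpos x - x.
  by rewrite -[in X in _ = _ - X](rposB x) opprB addrACA subrr addr0 addrC.
apply: (@rle_anti _ _ S).
  apply: rabs_le; first by apply: (rle_trans (rle_pos x)); apply: rle_addr; exact: rpos_ge0.
  by apply: (rle_trans (rle_pos (- x))); apply: rle_addrl; exact: rpos_ge0.
rewrite e; apply/rle_subl.
have : rpos x <=: 2^-1 *: (rabs x + x).
  apply: rpos_le.
    by rewrite -[X in X <=: _]half_double; apply: rle_scale; [lra|apply: rle_add; exact: rle_abs].
  apply: rge0Z; first lra.
  by apply/rle_subl; rewrite sub0r; exact: rleN_abs.
have two : (0 : R) <= 2 by lra.
by move=> /(rle_scale two); rewrite scalerA mulfV ?scale1r// scaler_nat mulr2n.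
Qed.

(** * Disjoint elements and Riesz decomposition *)

Lemma rdisjC a b : rdisj a b -> rdisj b a.
Proof. by move=> d z za zb; exact: d. Qed.

Lemma rdisjS a b a' b' : rdisj a b -> a' <=: a -> b' <=: b -> rdisj a' b'.
Proof. by move=> d aa bb z za zb; apply: d; [exact: rle_trans aa|exact: rle_trans bb]. Qed.

(** If [z] is below [a + a'] and below [b], then [z - a] is below [a'] and, [a] being positive,
    below [b]; hence [z] is below [a]. *)
Lemma rdisjDl a a' b : 0 <=: a -> rdisj a b -> rdisj a' b -> rdisj (a + a') b.
Proof.
move=> a0 d d' z za zb; apply: d => //.
have : z - a <=: 0.
  apply: d'; first by apply/rle_subl; rewrite addrC.
  by apply/rle_subl; apply: (rle_trans zb); exact: rle_addr.
by move=> /rle_subl; rewrite add0r.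
Qed.

Lemma rdisj_suml (I : eqType) (s : seq I) (a : I -> V) b :
  (forall i, i \in s -> 0 <=: a i /\ rdisj (a i) b) ->
  rdisj (\sum_(i <- s) a i) b.
Proof.
elim: s => [|i s IH] h; first by rewrite big_nil.
have [i0 ib] := h i (mem_head _ _).
rewrite big_cons; apply: rdisjDl => //; apply: IH => j js; apply: h.
by rewrite inE js orbT.
Qed.

Lemma rdisjZl c a b : 0 <= c -> 0 <=: a -> 0 <=: b -> rdisj a b -> rdisj (c *: a) b.
Proof.
move=> c0 a0 b0 d z za zb.
(* [c + 1] exceeds both [c] and [1], so [(c + 1)^-1 *: z] is below [a] and below [b]. *)
have k0 : 0 < c + 1 by lra.
have k1 : 0 <= (c + 1)^-1 by rewrite invr_ge0 ltW.
apply: (@rle_scaleK (c + 1)^-1); first by rewrite invr_gt0.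
rewrite scaler0; apply: d.
  apply: rle_trans (rle_scale k1 za) _; rewrite scalerA -[X in _ <=: X]scale1r.
  by apply: rle_scaleW => //; rewrite mulrC ler_pdivrMr//; lra.
apply: rle_trans (rle_scale k1 zb) _; rewrite -[X in _ <=: X]scale1r.
by apply: rle_scaleW => //; rewrite invf_le1//; lra.
Qed.

(** The element [a + b - x] is below both [a] and [b]. *)
Lemma rdisj_add_le a b x : a <=: x -> b <=: x -> rdisj a b -> a + b <=: x.
Proof.
move=> ax bx d.
have : a + b - x <=: 0.
  apply: d; apply/rle_subl; first exact: rle_addl.
  by rewrite addrC; exact: rle_addl.
by move=> /rle_subl; rewrite add0r.
Qed.

Lemma rdisj_sum_le (s : seq nat) (a : nat -> V) x : uniq s -> 0 <=: x ->
  (forall i, i \in s -> 0 <=: a i /\ a i <=: x) ->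
  (forall i j, i <> j -> rdisj (a i) (a j)) ->
  \sum_(i <- s) a i <=: x.
Proof.
move=> + x0 + d; elim: s => [|i s IH] /=; first by rewrite big_nil.
move=> /andP[nis us] h; rewrite big_cons.
apply: rdisj_add_le.
- exact: (h i (mem_head _ _)).2.
- by apply: IH => // j js; apply: h; rewrite inE js orbT.
- apply: rdisjC; apply: rdisj_suml => j js; split.
    by apply: (h j _).1; rewrite inE js orbT.
  by apply: d => ji; rewrite -ji js in nis.
Qed.

(** Half of [rabs x + rabs y - rabs (x + y)] is below both moduli, by the triangle inequality. *)
Lemma rdisj_abs_add x y : rdisj (rabs x) (rabs y) ->
  rabs x + rabs y <=: rabs (x + y).
Proof.
move=> d.
have h0 : (0 : R) <= 2^-1 by lra.
have : 2^-1 *: (rabs x + rabs y - rabs (x + y)) <=: 0.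
  apply: d.
    rewrite -[X in _ <=: X]half_double; apply: rle_scale => //; rewrite -addrA.
    apply: rle_addl; apply/rle_subl; rewrite addrC; apply/rle_subl.
    by rewrite [x + y]addrC; exact: rabs_sub.
  rewrite -[X in _ <=: X]half_double; apply: rle_scale => //; rewrite addrAC.
  apply: rle_add; apply/rle_subl; rewrite addrC; apply/rle_subl; exact: rabs_sub.
rewrite -{1}(scaler0 V 2^-1) => /rle_scaleK h.
have /h/rle_subl : 0 < 2^-1 :> R by lra.
by rewrite add0r.
Qed.

(** This is how disjointness of a sequence yields the domination required by [hahn_banach_seq]. *)
Lemma rdisj_sum_abs (x : nat -> V) (c : nat -> R) n :
  (forall i j, i <> j -> rdisj (rabs (x i)) (rabs (x j))) ->
  \sum_(0 <= i < n) `|c i| *: rabs (x i) <=: rabs (\sum_(0 <= i < n) c i *: x i).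
Proof.
move=> d; elim: n => [|n IH]; first by rewrite !big_geq// rabs0; exact: rle_refl.
rewrite !big_nat_recr//=.
apply: rle_trans (rle_add _ IH) _; rewrite -rabsZ; apply: rdisj_abs_add.
have Z i j : i <> j -> rdisj (rabs (c i *: x i)) (rabs (c j *: x j)).
  move=> ij; rewrite !rabsZ; apply: rdisjZl; rewrite ?normr_ge0//.
  - exact: rabs_ge0.
  - by apply: rge0Z; rewrite ?normr_ge0//; exact: rabs_ge0.
  - apply: rdisjC; apply: rdisjZl; rewrite ?normr_ge0//; try exact: rabs_ge0.
    by apply: d; exact/nesym.
apply: rdisjS (rabs_sum _ _) (rle_refl _ _).
apply: rdisj_suml => i; rewrite mem_index_iota => /andP[_ lt]; split.
  exact: rabs_ge0.
by apply: Z => e; rewrite e ltnn in lt.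
Qed.

(** A common lower bound [z] makes [rpos c - z] an upper bound of both [c] and [0], hence of
    [rpos c]. *)
Lemma rdisj_pos c : rdisj (rpos c) (rpos (- c)).
Proof.
move=> z zp zn.
have h : rpos c <=: rpos c - z.
  apply: rpos_le; last by apply/rsub_ge0.
  apply/rle_subr; rewrite addrC; apply/rle_subr.
  apply: (rle_trans zn); rewrite -[X in _ <=: _ - X]rposB opprB addrCA subrr addr0.
  exact: rle_refl.
by move: h => /rle_subr/(rle_add (- rpos c)); rewrite addrAC subrr add0r.
Qed.

(** The second difference is [- k^-1] times the first, so up to a positive factor these are the
    positive and negative parts of one element. The disjointness of truncated sequences rests on
    this. *)
Lemma rdisj_pos_sub (a b : V) (k : R) : 0 < k ->
  rdisj (rpos (a - k *: b)) (rpos (b - k^-1 *: a)).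
Proof.
move=> k0; have -> : b - k^-1 *: a = k^-1 *: (- (a - k *: b)).
  by rewrite opprB scalerBr scalerA mulVf ?gt_eqF// scale1r.
have ik : 0 <= k^-1 by rewrite invr_ge0 ltW.
rewrite rposZ//; apply: rdisjC; apply: rdisjZl => //; try exact: rpos_ge0.
exact/rdisjC/rdisj_pos.
Qed.

(** [z1] is [z] truncated to the order interval from [- x] to [x]. The last bound keeps both pieces
    in any ideal containing [z]. *)
Lemma riesz_decomposition z x y : 0 <=: x -> 0 <=: y -> rabs z <=: x + y ->
  exists z1 z2, [/\ z = z1 + z2, rabs z1 <=: x, rabs z2 <=: y
    & rabs z1 <=: rabs z].
Proof.
move=> x0 y0 zxy.
(* [m] is the infimum of [z] and [x]. *)
pose m := z - rpos (z - x).
have mz : m <=: z by apply/rle_subl/rle_addr; exact: rpos_ge0.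
have mx : m <=: x.
  apply/rle_subl; rewrite addrC; apply/rle_subl; exact: rle_pos.
have gm w : w <=: z -> w <=: x -> w <=: m.
  move=> wz wx; apply/rle_subr; rewrite addrC; apply/rle_subr.
  apply: rpos_le; last exact/rsub_ge0.
  exact: rle_addl (rleN wx).
have nx : - x <=: x.
  by apply: rle_trans (x0); apply: rleNl; rewrite oppr0.
have nz : - rabs z <=: z by apply: rleNl; exact: rleN_abs.
have n0 : - rabs z <=: 0 by apply: rleNl; rewrite oppr0; exact: rabs_ge0.
pose z1 := rjoin S m (- x).
exists z1, (z - z1); split.
- by rewrite addrC subrK.
- apply: rabs_le; first exact: rjoin_lub.
  by apply: rleNl; exact: rjoin_ubr.
- apply: rabs_le.
    apply: rle_trans (_ : z - m <=: _).
      by apply: rle_addl; apply: rleN; exact: rjoin_ubl.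
    rewrite /m opprB addrCA subrr addr0.
    apply: rpos_le => //; apply/rle_subl; rewrite addrC.
    exact: rle_trans (rle_abs z) zxy.
  rewrite opprB; apply/rle_subl; apply: rjoin_lub.
    by apply: rle_trans mz _; exact: rle_addrl.
  rewrite addrC; apply: rleNl; rewrite opprD; apply/rle_subl.
  by apply: rle_trans (rleN_abs z) zxy.
- apply: rabs_le.
    apply: rjoin_lub; first exact: rle_trans mz (rle_abs z).
    by apply: rle_trans (rabs_ge0 z); apply: rleNl; rewrite oppr0.
  apply: rleNl; apply: rle_trans (rjoin_ubl _ _ _); apply: gm => //.
  exact: rle_trans n0 x0.
Qed.

(** * The norm and monotone seminorms *)

Lemma rnorm_le x y : rabs x <=: rabs y -> N x <= N y.
Proof. exact: rnorm_mono. Qed.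

Lemma rnorm_abs x : N (rabs x) = N x.
Proof.
by apply/eqP; rewrite eq_le; apply/andP; split; apply: rnorm_le;
  rewrite (rabs_pos (rabs_ge0 x)); exact: rle_refl.
Qed.

Lemma rnorm_ge0 x : 0 <= N x.
Proof. exact: seminorm_ge0 (rnorm_seminorm S). Qed.

Definition monotone_seminorm (q : V -> R) : Prop :=
  seminorm q /\ forall x y, rabs x <=: rabs y -> q x <= q y.

(** Otherwise some [x n] of norm at most [1] have [q (x n) = 4 ^+ n], and the common order bound [v]
    of the [2^-1 ^+ n *: rabs (x n)] satisfies [2 ^+ n <= q v] for all [n]. *)
Lemma monotone_seminorm_bounded q : monotone_seminorm q ->
  exists C, forall x, q x <= C * N x.
Proof.
move=> [sq mq]; apply: contrapT => nb.
have ex n : exists x, 4 ^+ n = q x /\ N x <= 1.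
  have [x] : exists x, ~ (q x <= 4 ^+ n * N x).
    by apply/existsNP => h; apply: nb; exists (4 ^+ n).
  move=> /negP; rewrite -ltNge => lt.
  have p4 : 0 < 4 ^+ n :> R by rewrite exprn_gt0//; lra.
  have qx : 0 < q x.
    by apply: le_lt_trans lt; rewrite mulr_ge0 ?rnorm_ge0 ?ltW.
  have k0 : 0 <= 4 ^+ n / q x by rewrite divr_ge0 ?ltW.
  exists ((4 ^+ n / q x) *: x).
  rewrite (sq.2) (rnorm_seminorm S).2 ger0_norm// divfK ?gt_eqF//; split=> //.
  by rewrite mulrAC ler_pdivrMr// mul1r ltW.
have [x xP] := choice ex.
have [||v vP] := @rnorm_sigma _ _ S (fun n => rabs (x n)) 1.
- by move=> n; exact: rabs_ge0.
- by move=> n; rewrite rnorm_abs; exact: (xP n).2.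
have v0 : 0 <=: v.
  apply: rle_trans (vP 0%N); rewrite expr0 scale1r; exact: rabs_ge0.
have h n : 2 ^+ n <= q v.
  have <- : q (2^-1 ^+ n *: x n) = 2 ^+ n.
    rewrite sq.2 -(xP n).1 ger0_norm ?exprn_ge0 ?invr_ge0//.
    by rewrite -exprMn; congr (_ ^+ n); lra.
  apply: mq; rewrite rabsZ ger0_norm ?exprn_ge0 ?invr_ge0//.
  by rewrite (rabs_pos v0); exact: vP.
have hn n : n%:R <= (2 : R) ^+ n.
  elim: n => // n IH; rewrite exprS -natr1.
  have : (1 : R) <= 2 ^+ n by rewrite exprn_ege1//; lra.
  lra.
have := archi_boundP (seminorm_ge0 v sq); rewrite ltNge => /negP; apply.
exact: le_trans (hn _) (h _).
Qed.

End RieszTheory.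
(** * Summable sequences of linear forms on weakly compact sets *)

Definition null_seq (R : realType) (u : nat -> R) : Prop :=
  forall e, 0 < e -> exists n0, forall n, (n0 <= n)%N -> `|u n| <= e.

Lemma null_seqP (R : realType) (u : nat -> R) :
  null_seq u <-> (u @ \oo --> (0 : R)).
Proof.
split=> [nu|/cvgr0Pnorm_le cu e e0].
  apply/cvgr0Pnorm_le => e e0; have [n0 h] := nu e e0.
  by exists n0 => // n /= /h.
by have [n0 _ h] := cu e e0; exists n0 => n n0n; apply: h.
Qed.

Lemma not_null_seq (R : realType) (u : nat -> R) : ~ null_seq u ->
  exists2 e, 0 < e & exists t : nat -> nat, forall n, (n <= t n)%N /\ e < `|u (t n)|.
Proof.
move=> /existsNP[e /not_implyP[e0 /forallNP h]]; exists e => //.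
have ex n : exists m, (n <= m)%N /\ e < `|u m|.
  have /existsNP[m /not_implyP[nm /negP]] := h n.
  by rewrite -ltNge => lt; exists m.
by have [t tP] := choice ex; exists t.
Qed.

Section WeakTopology.
Variables (R : realType) (V : lmodType R) (S : rieszSpace V).
Local Notation "x <=: y" := (rle S x y) (at level 70).
Local Notation N := (rnorm S).

Definition rdual (f : V -> R) : Prop :=
  linform f /\ exists C, forall x, `|f x| <= C * N x.

Definition wnull (x : nat -> V) : Prop :=
  forall f, rdual f -> null_seq (fun n => f (x n)).

(** Weak cluster points without a topology: the first [m] forms of [g] and the radius [e] describe a
    basic weak neighbourhood of [z]. *)
Definition wcluster (a : nat -> V) (z : V) : Prop :=
  forall (g : nat -> V -> R) (m n0 : nat) (e : R),
    (forall i, rdual (g i)) -> 0 < e ->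
    exists2 n, (n0 <= n)%N &
      forall i, (i < m)%N -> `|g i (a n) - g i z| <= e.

(** The cluster point may lie outside [A], as befits relative compactness. *)
Definition weakly_cluster_compact (A : set V) : Prop :=
  forall a : nat -> V, (forall n, A (a n)) -> exists z, wcluster a z.

Definition summable_forms (g : nat -> V -> R) : Prop :=
  (forall n, linform (g n)) /\
  exists C, forall x s, uniq s -> \sum_(i <- s) `|g i x| <= C * N x.

Lemma summable_forms_dual g n : summable_forms g -> rdual (g n).
Proof.
move=> [lg [C gC]]; split=> //; exists C => x.
by have := gC x [:: n] isT; rewrite big_seq1.
Qed.

Lemma summable_forms_comp g (t : nat -> nat) :
  injective t -> summable_forms g -> summable_forms (g \o t).
Proof.
move=> it [lg [C gC]]; split=> [n|]; first exact: lg.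
exists C => x s us; have := gC x [seq t i | i <- s].
by rewrite big_map map_inj_uniq//; apply.
Qed.

(** A finite set [s0] of indices brings the sum within [e] of its supremum; a finite set beyond [s0]
    can then add at most [e]. *)
Lemma summable_forms_tail g x e : summable_forms g -> 0 < e ->
  exists n0, forall s, uniq s -> all (fun i => n0 <= i)%N s ->
    \sum_(i <- s) `|g i x| <= e.
Proof.
move=> [lg [C gC]] e0.
pose A := [set \sum_(i <- s) `|g i x| | s in [set s : seq nat | uniq s]].
have hA : has_sup A.
  split; first by exists (\sum_(i <- [::]) `|g i x|); exists [::].
  by exists (C * N x) => _ [s us <-]; exact: gC.
have [_ [s0 /= us0 <-] lt] := sup_adherent e0 hA.
exists (\max_(i <- s0) i).+1 => s us /allP h.
have : A (\sum_(i <- s0 ++ s) `|g i x|).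
  exists (s0 ++ s) => //=; rewrite cat_uniq us0 us andbT /=.
  apply/hasPn => i /h lt1; apply/negP => is0.
  have := leq_trans lt1 (@leq_bigmax_seq _ _ xpredT (fun i : nat => i) _ is0 isT).
  by rewrite ltnn.
by move=> /(ub_le_sup hA.2); rewrite big_cat /=; lra.
Qed.

Lemma summable_forms_sum g : summable_forms g ->
  exists2 h, rdual h & forall x e, 0 < e -> exists m0, forall m, (m0 <= m)%N ->
    `|h x - \sum_(0 <= i < m) g i x| <= e.
Proof.
move=> sg; have [lg [C gC]] := sg.
have cg x : cvgn (series (fun i => g i x)).
  apply: (@normed_cvg R R^o); apply: nondecreasing_is_cvgn.
    by apply: nondecreasing_series => n _ _; exact: normr_ge0.
  by exists (C * N x) => _ [n _ <-]; apply: gC; exact: iota_uniq.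
exists (fun x => limn (series (fun i => g i x))); last first.
  move=> x e e0; have /cvgrPdist_le/(_ _ e0)[m0 _ h] := cg x.
  by exists m0 => m /h.
have lim_le x e : 0 < e -> `|limn (series (fun i => g i x))| <= C * N x + e.
  move=> e0; have /cvgrPdist_le/(_ _ e0)[m0 _ h] := cg x.
  have := h m0 (leqnn m0); have := gC x (index_iota 0 m0) (iota_uniq _ _).
  have := ler_norm_sum (index_iota 0 m0) (fun i => g i x) xpredT.
  rewrite /series /=; set T := \sum_(_ <- _) g _ _.
  have := ler_normD (limn (series (fun i => g i x)) - T) T; rewrite subrK.
  lra.
split; last by exists C => x; apply/ler_addgt0Pr => e; exact: lim_le.
move=> a x y; apply/cvg_lim => //.
have -> : series (fun i => g i (a *: x + y)) =
    (fun n => a * series (fun i => g i x) n + series (fun i => g i y) n).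
  apply/funext => n; rewrite /series /= mulr_sumr -big_split /=.
  by apply: eq_bigr => i _; rewrite lg.
by apply: cvgD; [apply: cvgMr; exact: cg|exact: cg].
Qed.

(* Schur's gliding hump: past a weak cluster point [y] one finds indices
   [nu k] such that [g (nu j)] is almost [g (nu j) y] at [a (nu k)] for [j < k]
   and almost [0] for [j > k]; then [\sum_j g (nu j)] separates the [a (nu k)]
   from every weak cluster point of that subsequence. *)
Theorem summable_forms_null g a : summable_forms g ->
  (forall t : nat -> nat, exists z, wcluster (a \o t) z) ->
  null_seq (fun n => g n (a n)).
Proof.
move=> sg ca; apply: contrapT => /not_null_seq[e e0 [t tP]].
have gd n : rdual (g n) := summable_forms_dual n sg.
have [y yP] := ca t.
(* Six error terms of size [d] are collected in the identity [E] below. *)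
pose d := e / 6; have d0 : 0 < d by rewrite /d; lra.
have step n : exists n', [/\ (n < n')%N,
    forall s, uniq s -> all (fun i => n' <= i)%N s -> \sum_(i <- s) `|g i (a n)| <= d,
    forall i, (i <= n)%N -> `|g i (a n') - g i y| <= d / n.+1%:R
    & e < `|g n' (a n')|].
  have [n1 n1P] := summable_forms_tail (a n) sg d0.
  have dn : 0 < d / n.+1%:R by rewrite divr_gt0.
  have [m le mP] := yP g n.+1 (maxn n1 n.+1) _ gd dn.
  have [mt lt] := tP m.
  exists (t m); split=> //.
  - by apply: leq_trans mt; apply: leq_trans le; rewrite leq_maxr.
  - move=> s us /allP h; apply: n1P => //; apply/allP => i /h; apply: leq_trans.
    by apply: leq_trans mt; apply: leq_trans le; rewrite leq_maxl.
have [st stP] := choice step.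
have [n0 n0P] := summable_forms_tail y sg d0.
pose nu k := iter k.+1 st n0.
have nuS k : (nu k < nu k.+1)%N by have [] := stP (nu k).
have nu_lt j k : (j < k)%N -> (nu j < nu k)%N.
  elim: k => // k IH; rewrite ltnS leq_eqVlt => /predU1P[->//|/IH h].
  exact: ltn_trans h (nuS k).
have nu_le j k : (j <= k)%N -> (nu j <= nu k)%N.
  by rewrite leq_eqVlt => /predU1P[->//|/nu_lt/ltnW].
have nu_inj : injective nu.
  move=> j k jk; have [/nu_lt|/nu_lt|//] := ltngtP j k; by rewrite jk ltnn.
have nu_ge k : (k <= nu k)%N.
  elim: k => // k IH; exact: leq_ltn_trans IH (nuS k).
have n0nu k : (n0 <= nu k)%N.
  apply: leq_trans (nu_le _ _ (leq0n k)).
  by have [/ltnW] := stP n0.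
have early j k : (j < k)%N -> `|g (nu j) (a (nu k)) - g (nu j) y| <= d / k%:R.
  case: k => // k; rewrite ltnS => jk.
  have [_ _ /(_ (nu j) (nu_le _ _ jk)) h _] := stP (nu k).
  apply: le_trans h _; apply: ler_wpM2l; first exact: ltW.
  by rewrite lef_pV2 ?posrE// ler_nat ltnS nu_ge.
have [z zP] := ca nu.
(* Along the subsequence, [g (nu j)] tends to its value at [y], so every weak cluster point takes
   that value. *)
have gz j : g (nu j) z = g (nu j) y.
  apply/eqP; rewrite -subr_eq0 -normr_le0; apply/ler_addgt0Pr => e' e'0; rewrite add0r.
  have e2 : 0 < e' / 2 by lra.
  have [k0 k0P] : exists k0, forall k, (k0 <= k)%N -> d / k%:R <= e' / 2.
    have de : 0 <= d / (e' / 2) by rewrite divr_ge0// ltW.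
    exists (Num.bound (d / (e' / 2))) => k kk.
    have kR : d / (e' / 2) < k%:R.
      by apply: lt_le_trans (archi_boundP de) _; rewrite ler_nat.
    have k0 : 0 < k%:R :> R by apply: le_lt_trans kR.
    by rewrite ler_pdivrMr// mulrC -ler_pdivrMr// ltW.
  have [k kk kP] := zP (fun _ => g (nu j)) 1%N (maxn k0 j.+1) _ (fun=> gd _) e2.
  have := kP 0%N isT; rewrite /= => h1.
  have h2 := early j k (leq_trans (leq_maxr _ _) kk).
  have h3 := k0P k (leq_trans (leq_maxl _ _) kk).
  have := ler_distD (g (nu j) (a (nu k))) (g (nu j) z) (g (nu j) y).
  by rewrite [`|g (nu j) z - g _ (a _)|]distrC; lra.
have [h hd hP] := summable_forms_sum (summable_forms_comp nu_inj sg).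
have [k _ kP] := zP (fun _ => h) 1%N 0%N _ (fun=> hd) d0.
have {kP}kP := kP 0%N isT; rewrite /= in kP.
have [m1 m1P] := hP (a (nu k)) _ d0.
have [m2 m2P] := hP z _ d0.
pose m := maxn k.+1 (maxn m1 m2).
have {m1P} := m1P m; have {m2P} := m2P m.
rewrite /m !leq_max !leqnn !orbT -/m => /(_ isT) m2P /(_ isT) m1P.
have km : (k < m)%N by rewrite /m leq_maxl.
have split_sum x : \sum_(0 <= i < m) (g \o nu) i x =
    \sum_(0 <= i < k) g (nu i) x + (g (nu k) x + \sum_(k.+1 <= i < m) g (nu i) x).
  by rewrite (@big_cat_nat _ _ _ k) ?(ltnW km)//= (@big_ltn _ _ _ k).
have tail_le x q : (forall s, uniq s -> all (fun i => q <= i)%N s ->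
    \sum_(i <- s) `|g i x| <= d) ->
    forall p, (q <= nu p)%N -> `|\sum_(p <= i < m) g (nu i) x| <= d.
  move=> h1 p qp; apply: le_trans (ler_norm_sum _ _ _) _.
  have := h1 [seq nu i | i <- index_iota p m]; rewrite big_map; apply.
    by rewrite map_inj_uniq// iota_uniq.
  apply/allP => _ /mapP[i + ->]; rewrite mem_index_iota => /andP[pi _].
  exact: leq_trans qp (nu_le _ _ pi).
have T1 : `|\sum_(k.+1 <= i < m) g (nu i) (a (nu k))| <= d.
  by have [_ hs _ _] := stP (nu k); apply: (tail_le _ _ hs).
have T2 : `|\sum_(k <= i < m) g (nu i) z| <= d.
  under eq_bigr do rewrite gz.
  exact: (tail_le _ _ n0P).
have T3 : `|\sum_(0 <= i < k) (g (nu i) (a (nu k)) - g (nu i) z)| <= d.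
  apply: le_trans (ler_norm_sum _ _ _) _.
  apply: le_trans (_ : \sum_(0 <= i < k) d / k%:R <= _).
    rewrite big_nat_cond [leRHS]big_nat_cond; apply: ler_sum => i.
    by rewrite andbT /= gz => ik; exact: early.
  rewrite sumr_const_nat subn0 -[leLHS]mulr_natr.
  by case: (k) => [|k']; [rewrite mulr0 ltW|rewrite divfK].
have ek : e < `|g (nu k) (a (nu k))| by have [] := stP (iter k st n0).
(* The sum [h] is cut at [k] and [m]. Of the six terms, three compare [h] with its cluster value and
   with its partial sums, and three are the head and the two tails. *)
have E : g (nu k) (a (nu k)) =
    (h (a (nu k)) - h z)
    - (h (a (nu k)) - \sum_(0 <= i < m) (g \o nu) i (a (nu k)))
    + (h z - \sum_(0 <= i < m) (g \o nu) i z)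
    - \sum_(0 <= i < k) (g (nu i) (a (nu k)) - g (nu i) z)
    - \sum_(k.+1 <= i < m) g (nu i) (a (nu k))
    + \sum_(k <= i < m) g (nu i) z.
  rewrite !split_sum sumrB (@big_ltn _ _ _ k)//; lra.
move: ek; rewrite E ltNge => /negP; apply.
have -> : e = 6 * d by rewrite /d; lra.
move: kP m1P m2P T1 T2 T3; rewrite !ler_norml.
move=> /andP[? ?] /andP[? ?] /andP[? ?] /andP[? ?] /andP[? ?] /andP[? ?].
by apply/andP; split; lra.
Qed.

Lemma geometric_half_sum (s : seq nat) : uniq s ->
  \sum_(i <- s) (2^-1 : R) ^+ i <= 2.
Proof.
move=> us; pose m := (\max_(i <- s) i).+1.
(* The remainder of the geometric series is kept explicitly, so the finite sum is compared without
   limits. *)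
have e2 : 2 = \sum_(0 <= i < m) (2^-1 : R) ^+ i + 2 * 2^-1 ^+ m.
  elim: (m) => [|k IH]; first by rewrite big_geq// expr0; lra.
  by rewrite big_nat_recr//= exprS; lra.
rewrite [leRHS]e2 -[leLHS]addr0; apply: lerD; last by rewrite mulr_ge0// exprn_ge0.
rewrite [leRHS](bigID (mem s)) /= -[leLHS]addr0; apply: lerD; last first.
  by apply: sumr_ge0 => i _; rewrite exprn_ge0.
rewrite -[leRHS]big_filter le_eqVlt; apply/predU1l/perm_big.
apply: uniq_perm => //; first by rewrite filter_uniq// iota_uniq.
move=> i; rewrite mem_filter mem_index_iota /= ltnS.
case: (boolP (i \in s)) => //= is0.
by rewrite (@leq_bigmax_seq _ _ xpredT (fun i : nat => i) _ is0 isT).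
Qed.

Lemma summable_geometric (f : nat -> V -> R) (M : R) :
  (forall n, linform (f n)) -> (forall n x, `|f n x| <= M * N x) ->
  summable_forms (fun n x => 2^-1 ^+ n * f n x).
Proof.
move=> lf fM; split=> [n b x y|]; first by rewrite lf; lra.
exists (2 * M) => x s us.
have le i : `|2^-1 ^+ i * f i x| <= 2^-1 ^+ i * (M * N x).
  rewrite normrM ger0_norm ?exprn_ge0//; apply: ler_wpM2l; last exact: fM.
  by rewrite exprn_ge0.
apply: le_trans (ler_sum _ (fun i _ => le i)) _.
rewrite -mulr_suml -mulrA; apply: ler_wpM2r; last exact: geometric_half_sum.
exact: le_trans (normr_ge0 _) (fM 0%N x).
Qed.

(** If [2 ^+ n <= N (a n)] and [f n] is a norming form for [a n], then the summable forms
    [2^-1 ^+ n * f n] take values at least [1] at [a n], against [summable_forms_null]. *)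
Lemma weakly_cluster_compact_bounded A : weakly_cluster_compact A ->
  exists M, forall x, A x -> N x <= M.
Proof.
move=> cA; apply: contrapT => nb.
have ex n : exists x, A x /\ 2 ^+ n <= N x.
  apply: contrapT => /forallNP h; apply: nb; exists (2 ^+ n) => x Ax.
  by have /not_andP[//|/negP] := h x; rewrite -ltNge => /ltW.
have [a aP] := choice ex.
have [f fP] := choice (fun n => hahn_banach1 (a n) (rnorm_seminorm S)).
pose g n x := 2^-1 ^+ n * f n x.
have sg : summable_forms g.
  apply: (@summable_geometric f 1) => n; first by have [] := fP n.
  by move=> x; rewrite mul1r; have [_ ->] := fP n.
have half : 0 < 2^-1 :> R by lra.
have [n0 h] := summable_forms_null sg
  (fun t => cA (a \o t) (fun n => (aP (t n)).1)) half.
have := h n0 (leqnn _); rewrite /g.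
have [_ _ ->] := fP n0; rewrite leNgt => /negP; apply.
apply: lt_le_trans (ler_norm _).
have p : 0 <= (2^-1 : R) ^+ n0 by rewrite exprn_ge0.
apply: lt_le_trans (ler_wpM2l p (aP n0).2).
rewrite -exprMn mulVf ?expr1n//; lra.
Qed.

End WeakTopology.
(** * Disjoint sequences in solid hulls *)

Section SolidHulls.
Variables (R : realType) (V : lmodType R) (S : rieszSpace V).
Local Notation "x <=: y" := (rle S x y) (at level 70).
Local Notation N := (rnorm S).
Local Notation rabs := (rabs S).
Local Notation rpos := (rpos S).
Local Notation rdisj := (rdisj S).

Definition rdisjoint_seq (x : nat -> V) : Prop :=
  forall i j, i <> j -> rdisj (rabs (x i)) (rabs (x j)).

Lemma seminorm_of_le (q : V -> R) : (forall x y, q (x + y) <= q x + q y) ->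
  (forall (a : R) x, q (a *: x) <= `|a| * q x) -> seminorm q.
Proof.
move=> qD qZ; split=> // a x; apply/eqP; rewrite eq_le qZ /=.
have [->|a0] := eqVneq a 0.
  rewrite normr0 mul0r scale0r; have := qD 0 0; rewrite addr0; lra.
have := ler_wpM2l (normr_ge0 a) (qZ a^-1 (a *: x)).
by rewrite scalerA mulVf// scale1r mulrA -normrM mulfV// normr1 mul1r.
Qed.

Lemma rabs_le0 x : rabs x <=: 0 -> x = 0.
Proof.
move=> x0; apply: (@rle_anti _ _ S); first exact: rle_trans (rle_abs _ _) x0.
have := rleN (rle_trans (rleN_abs _ _) x0).
by rewrite opprK oppr0.
Qed.

Lemma rdual_bound f : rdual S f -> exists2 C, 0 <= C &
  forall x y, rabs x <=: rabs y -> `|f x| <= C * N y.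
Proof.
move=> [_ [C fC]]; exists `|C| => // x y xy.
apply: le_trans (fC x) _; apply: le_trans (ler_wpM2r (rnorm_ge0 _ _) (ler_norm C)) _.
by apply: ler_wpM2l => //; exact: rnorm_le.
Qed.

(* The modulus of [f] restricted to the ideal generated by [u]. *)
Definition ideal_sup (f : V -> R) (u x : V) : R :=
  sup [set `|f z| | z in [set z | rabs z <=: rabs x /\
    exists2 k, 0 <= k & rabs z <=: k *: rabs u]].

Section IdealSup.
Variables (f : V -> R) (fd : rdual S f).

Lemma ideal_sup_has_sup u x :
  has_sup [set `|f z| | z in [set z | rabs z <=: rabs x /\
    exists2 k, 0 <= k & rabs z <=: k *: rabs u]].
Proof.
split.
  exists `|f 0|, 0 => //=; rewrite rabs0; split; first exact: rabs_ge0.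
  by exists 0 => //; rewrite scale0r; exact: rle_refl.
have [C _ fC] := rdual_bound fd.
by exists (C * N x) => _ [z [zx _] <-]; exact: fC.
Qed.

Lemma ideal_sup_ge u x z k : rabs z <=: rabs x -> 0 <= k ->
  rabs z <=: k *: rabs u -> `|f z| <= ideal_sup f u x.
Proof.
move=> zx k0 zu; apply: (ub_le_sup (ideal_sup_has_sup u x).2).
by exists z => //; split=> //; exists k.
Qed.

Lemma ideal_sup_le u x M :
  (forall z k, rabs z <=: rabs x -> 0 <= k -> rabs z <=: k *: rabs u ->
    `|f z| <= M) -> ideal_sup f u x <= M.
Proof.
move=> h; apply: ge_sup; first exact: (ideal_sup_has_sup u x).1.
by move=> _ [z [zx [k k0 zk]] <-]; exact: h zx k0 zk.
Qed.

Lemma ideal_sup_seminorm u : seminorm (ideal_sup f u).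
Proof.
have lf := fd.1; apply: seminorm_of_le => [x y|a x].
  apply: ideal_sup_le => z k zxy k0 zu.
  have [z1 [z2 [e h1 h2 h3]]] := riesz_decomposition
    (rabs_ge0 S x) (rabs_ge0 S y) (rle_trans zxy (rabsD S x y)).
  rewrite e (linformD _ _ lf); apply: le_trans (ler_normD _ _) _; apply: lerD.
    exact: ideal_sup_ge h1 k0 (rle_trans h3 zu).
  (* The second piece is [z - z1], and both [z] and [z1] are bounded by [k *: rabs u]. *)
  apply: (@ideal_sup_ge _ _ _ (k + k)) => //; first by rewrite addr_ge0.
  have -> : z2 = z - z1 by rewrite e addrAC subrr add0r.
  apply: rle_trans (rabsD _ _ _) _; rewrite rabsN scalerDl; apply: rleD => //.
  exact: rle_trans h3 zu.
apply: ideal_sup_le => z k + k0 zu; rewrite rabsZ.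
have [->|a0] := eqVneq a 0.
  by rewrite !normr0 scale0r mul0r => /rabs_le0 ->; rewrite (linform0 lf) normr0.
move=> zx; have na : 0 < `|a| by rewrite normr_gt0.
have ia : 0 <= `|a|^-1 by rewrite invr_ge0.
have -> : z = a *: (a^-1 *: z) by rewrite scalerA mulfV// scale1r.
rewrite (linformZ _ _ lf) normrM; apply: ler_wpM2l => //.
apply: (@ideal_sup_ge _ _ _ (`|a|^-1 * k)); rewrite ?rabsZ ?normfV.
- by have := rle_scale ia zx; rewrite scalerA mulVf ?gt_eqF// scale1r.
- by rewrite mulr_ge0.
- by rewrite -scalerA; exact: rle_scale.
Qed.

(** Nearly optimal [z i] in the ideals of the [x i] are disjoint. Their signed sum [w] is therefore
    bounded by [rabs y], while [f w] is the sum of the [|f (z i)|]. *)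
Lemma ideal_sup_sum (x : nat -> V) : rdisjoint_seq x ->
  exists C, forall y s, uniq s -> \sum_(i <- s) ideal_sup f (x i) y <= C * N y.
Proof.
move=> dx; have [C _ fC] := rdual_bound fd; exists C => y s us.
apply/ler_addgt0Pr => e e0.
(* The successor avoids a division by zero for empty [s]; the total error [size s * d] is still at
   most [e]. *)
pose d := e / (size s).+1%:R.
have d0 : 0 < d by rewrite divr_gt0.
have ex i : exists z, [/\ rabs z <=: rabs y,
    exists2 k, 0 <= k & rabs z <=: k *: rabs (x i)
    & ideal_sup f (x i) y - d <= `|f z|].
  have [_ [z [zy zk] <-] lt] := sup_adherent d0 (ideal_sup_has_sup (x i) y).
  by exists z; split=> //; exact: ltW.
have [z zP] := choice ex.
have dz i j : i <> j -> rdisj (rabs (z i)) (rabs (z j)).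
  move=> ij; have [_ [k k0 zk] _] := zP i; have [_ [l l0 zl] _] := zP j.
  apply: rdisjS zk zl; apply: rdisjZl => //; try exact: rabs_ge0.
    by apply: rge0Z => //; exact: rabs_ge0.
  apply: rdisjC; apply: rdisjZl => //; try exact: rabs_ge0.
  exact/dx/nesym.
have h1 : \sum_(i <- s) ideal_sup f (x i) y <= \sum_(i <- s) (`|f (z i)| + d).
  by apply: ler_sum => i _; have [_ _] := zP i; lra.
apply: le_trans h1 _; rewrite big_split /=; apply: lerD; last first.
  rewrite big_const_seq count_predT iter_addr addr0 -[leLHS]mulr_natr /d.
  rewrite mulrAC ler_pdivrMr//; apply: ler_wpM2l; first exact: ltW.
  by rewrite ler_nat.
pose w := \sum_(i <- s) ((-1) ^+ (f (z i) < 0)%R : R) *: z i.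
have -> : \sum_(i <- s) `|f (z i)| = f w.
  rewrite (linform_sum _ _ fd.1); apply: eq_bigr => i _.
  by rewrite (linformZ _ _ fd.1) normrEsign.
apply: le_trans (ler_norm _) _; apply: fC.
apply: rle_trans (rabs_sum _ _ _) _.
under eq_bigr do rewrite rabsZ normr_sign scale1r.
apply: rdisj_sum_le => //; first exact: rabs_ge0.
by move=> i _; split; [exact: rabs_ge0|have [] := zP i].
Qed.

End IdealSup.

(** A form [g n] dominated by [ideal_sup f (x n)] and norming at [a n] satisfies
    [|f (x n)| <= g n (a n)]. These forms are summable, so [summable_forms_null] applies along
    [a]. *)
Theorem disjoint_solid_wnull (x a : nat -> V) : rdisjoint_seq x ->
  (forall n, rabs (x n) <=: rabs (a n)) ->
  (forall t : nat -> nat, exists z, wcluster S (a \o t) z) -> wnull S x.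
Proof.
move=> dx xa ca f fd.
have [g gP] := choice (fun n => hahn_banach1 (a n) (ideal_sup_seminorm fd (x n))).
have [C sC] := ideal_sup_sum fd dx.
have sg : summable_forms S g.
  split=> [n|]; first by have [] := gP n.
  exists C => y s us; apply: le_trans (sC y s us); apply: ler_sum => i _.
  by have [_ ->] := gP i.
move=> e e0; have [n0 h] := summable_forms_null sg ca e0.
exists n0 => n /h; apply: le_trans; have [_ _ ->] := gP n.
apply: le_trans (ler_norm _).
by apply: (ideal_sup_ge fd _ ler01); rewrite ?scale1r; [exact: xa|exact: rle_refl].
Qed.

(** Some form bounded by [q], hence by the norm, takes the value [r n] at [x n]. *)
Lemma wnull_dominated (x : nat -> V) (q : V -> R) (r : nat -> R) :
  wnull S x -> monotone_seminorm S q ->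
  (forall n (c : nat -> R),
    \sum_(0 <= i < n) c i * r i <= q (\sum_(0 <= i < n) c i *: x i)) ->
  null_seq r.
Proof.
move=> wx mq qx; have [g [lg gq gx]] := hahn_banach_seq mq.1 qx.
have [C qC] := monotone_seminorm_bounded mq.
have gd : rdual S g by split=> //; exists C => y; exact: le_trans (gq y) (qC y).
by move=> e e0; have [n0 h] := wx g gd e e0; exists n0 => n /h; rewrite gx.
Qed.

Definition order_null (b : nat -> V -> R) : Prop :=
  forall v e, 0 < e -> exists n0, forall n, (n0 <= n)%N ->
    forall z, rabs z <=: v -> `|b n z| <= e.

Lemma exists_increasing (P : nat -> nat -> Prop) :
  (forall n, exists2 m, (n < m)%N & P n m) ->
  exists t : nat -> nat, {homo t : i j / (i < j)%N} /\ forall k, P (t k) (t k.+1).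
Proof.
move=> h; have ex n : exists m, (n < m)%N /\ P n m.
  by have [m ? ?] := h n; exists m.
have [st stP] := choice ex; exists (fun k => iter k st 0%N); split.
  by apply: homo_ltn => [|k]; [exact: ltn_trans|exact: (stP _).1].
by move=> k; exact: (stP _).2.
Qed.

Lemma increasing_ge (t : nat -> nat) k : {homo t : i j / (i < j)%N} -> (k <= t k)%N.
Proof. by move=> ht; elim: k => // k IH; exact: leq_ltn_trans IH (ht _ _ _). Qed.

Lemma disjointification (x : nat -> V) (b : nat -> V -> R) (M e : R) :
  (forall n, 0 <=: x n) -> (forall n, N (x n) <= M) ->
  (forall n, linform (b n)) -> order_null b -> 0 < e ->
  (forall n, e < `|b n (x n)|) ->
  exists (t : nat -> nat) (z : nat -> V), [/\ {homo t : i j / (i < j)%N},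
    forall k, 0 <=: z k /\ z k <=: x (t k), rdisjoint_seq z
    & exists k0, forall k, (k0 <= k)%N -> e / 2 <= `|b (t k) (z k)|].
Proof.
move=> x0 xM lb ob e0 be.
have e4 : 0 < e / 4 by lra.
(* All indices up to [n] are summed, not only the selected ones, so that the condition linking [t k]
   to [t k.+1] involves no earlier choice. *)
pose W n := \sum_(m <- index_iota 0 n.+1) x m.
have [t [ht tP]] : exists t : nat -> nat, {homo t : i j / (i < j)%N} /\
    forall k z, rabs z <=: 4 ^+ (t k).+1 *: W (t k) -> `|b (t k.+1) z| <= e / 4.
  apply: (@exists_increasing (fun n m =>
    forall z, rabs z <=: 4 ^+ n.+1 *: W n -> `|b m z| <= e / 4)) => n.
  have [n0 h] := ob (4 ^+ n.+1 *: W n) _ e4.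
  exists (maxn n0 n.+1); first by rewrite leq_maxr.
  by apply: h; rewrite leq_maxl.
have [u uP] := rnorm_sigma (fun k => x0 (t k)) (fun k => xM (t k)).
have u0 : 0 <=: u by apply: rle_trans (uP 0%N); rewrite expr0 scale1r.
have p2 n : 0 <= (2^-1 : R) ^+ n by rewrite exprn_ge0.
have p4 n : 0 < (4 : R) ^+ n by rewrite exprn_gt0.
have W0 n : 0 <=: W n by apply: rge0_sum.
have xW m n : (m <= n)%N -> x m <=: W n.
  move=> mn; rewrite /W (bigD1_seq m) ?iota_uniq ?mem_index_iota ?ltnS//=.
  by rewrite -big_filter; apply: rle_addr; apply: rge0_sum.
pose v1 k := 4 ^+ (t k).+1 *: W (t k).
pose v2 k := 2^-1 ^+ k.+1 *: u.
have v10 k : 0 <=: v1 k by apply: rge0Z => //; exact: ltW.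
have v20 k : 0 <=: v2 k by apply: rge0Z.
pose z k := rpos (x (t k.+1) - (v1 k + v2 k)).
have zx k : z k <=: x (t k.+1).
  by apply: rpos_le => //; apply/rle_subl; apply: rle_addr; exact: rge0D.
have z0 k : 0 <=: z k by exact: rpos_ge0.
have dz j k : (j < k)%N -> rdisj (z k) (z j).
  (* With the factor [4 ^+ k.+1], [z k] is below the first positive part because [v1 k] contains
     [x (t j.+1)]. [z j] is below the second because [v2 j] is at least
     [2^-1 ^+ j.+1 * 2^-1 ^+ k.+1] times [x (t k.+1)]. *)
  move=> jk; have dk := @rdisj_pos_sub _ _ S (x (t k.+1)) (x (t j.+1)) _ (p4 k.+1).
  apply: (rdisjS dk).
    apply: rpos_mono; apply: rle_addl; apply: rleN.
    apply: rle_trans (rle_addr (v1 k) (v20 k)).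
    apply: rle_trans (_ : 4 ^+ k.+1 *: W (t k) <=: _).
      apply: rle_scale; first exact: ltW.
      by apply: xW; move: jk; rewrite leq_eqVlt => /predU1P[->//|/ht/ltnW].
    apply: rle_scaleW => //; rewrite ler_weXn2l//; first lra.
    by rewrite ltnS; exact: increasing_ge.
  apply: rpos_mono; apply: rle_addl; apply: rleN.
  apply: rle_trans (rle_addrl (v2 j) (v10 j)).
  apply: rle_trans (rle_scale (p2 j.+1) (uP k.+1)).
  rewrite scalerA; apply: rle_scaleW => //.
  have -> : (4 ^+ k.+1)^-1 = 2^-1 ^+ k.+1 * 2^-1 ^+ k.+1 :> R.
    by rewrite -exprMn -exprVn; congr (_ ^+ _); lra.
  apply: ler_wpM2r => //; rewrite ler_wiXn2l//; try lra.
  by rewrite ltnS ltnW.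
exists (fun k => t k.+1), z; split=> //.
- by move=> i j ij; exact: ht.
- move=> i j ij; rewrite !rabs_pos//.
  have [/dz/rdisjC|/dz|//] := ltngtP i j; exact.
- have [k0 k0P] := ob u _ e4.
  exists k0 => k kk.
  set y := x (t k.+1).
  have w0 : 0 <=: y - z k by apply/rsub_ge0.
  have wv : rabs (y - z k) <=: v1 k + v2 k.
    rewrite rabs_pos//; apply/rle_subl; rewrite addrC; apply/rle_subl; exact: rle_pos.
  (* The part cut off splits along [v1 k] and [v2 k]; the choice of [t] controls the first piece and
     order nullity at [u] the second, each by [e / 4]. *)
  have [w1 [w2 [we h1 h2 _]]] := riesz_decomposition (v10 k) (v20 k) wv.
  have b1 := tP k w1 h1.
  have b2 : `|b (t k.+1) w2| <= e / 4.
    apply: k0P.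
      by apply: leq_trans kk _; apply: leq_trans (leqnSn k) _; exact: increasing_ge.
    apply: rle_trans h2 _; rewrite -[X in _ <=: X]scale1r; apply: rle_scaleW => //.
    by rewrite exprn_ile1//; lra.
  have : y = z k + (w1 + w2) by rewrite -we addrC subrK.
  have := be (t k.+1); rewrite -/y => + e1; rewrite e1 !(linformD _ _ (lb _)).
  have := ler_normD (b (t k.+1) (z k)) (b (t k.+1) w1 + b (t k.+1) w2).
  have := ler_normD (b (t k.+1) w1) (b (t k.+1) w2).
  lra.
Qed.

(** A failure gives positive elements of the solid hull on which [b] stays large.
    [disjointification] replaces them by a disjoint sequence, weakly null by [disjoint_solid_wnull],
    which contradicts the hypothesis on such sequences. *)
Theorem solid_hull_uniform_null (A : set V) (b : nat -> V -> R) :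
  weakly_cluster_compact S A -> (forall n, linform (b n)) -> order_null b ->
  (forall (t : nat -> nat) (z : nat -> V), {homo t : i j / (i < j)%N} ->
    rdisjoint_seq z -> wnull S z -> null_seq (fun k => b (t k) (z k))) ->
  forall e, 0 < e -> exists n0, forall n, (n0 <= n)%N ->
    forall x a, A a -> rabs x <=: rabs a -> `|b n x| <= e.
Proof.
move=> cA lb ob bz e e0; apply: contrapT => /forallNP nb.
pose bad n x := exists a, [/\ A a, x <=: rabs a, 0 <=: x & e / 2 < `|b n x|].
have exb n : exists2 m, (n < m)%N & exists x, bad m x.
  have /existsNP[m /not_implyP[nm]] := nb n.+1.
  move=> /existsNP[x /existsNP[a /not_implyP[Aa /not_implyP[xa /negP]]]].
  rewrite -ltNge => lt; exists m => //.
  (* One of the parts [rpos x] and [rpos (- x)] keeps more than half of the value. *)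
  have posa y : rabs y <=: rabs a -> e / 2 < `|b m (rpos y)| -> bad m (rpos y).
    move=> ya h; exists a; split=> //; last exact: rpos_ge0.
    exact: rle_trans (rpos_le_abs _ _) ya.
  have := ler_normB (b m (rpos x)) (b m (rpos (- x))).
  rewrite -(linformB _ _ (lb m)) rposB => h.
  have [h1|h1] := ltP (e / 2) `|b m (rpos x)|.
    by exists (rpos x); exact: posa.
  exists (rpos (- x)); apply: posa; first by rewrite rabsN.
  by lra.
have [t [ht tP]] := exists_increasing exb.
have [x xP] := choice tP.
have [a aP] := choice xP.
have [M MP] := weakly_cluster_compact_bounded cA.
have [||||||s [z [hs zx dz [k0 k0P]]]] :=
    @disjointification x (fun n => b (t n.+1)) M (e / 2).
- by move=> n; have [] := aP n.
- move=> n; have [Aa xa x0 _] := aP n; apply: le_trans (MP _ Aa).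
  by apply: rnorm_le; rewrite rabs_pos.
- by [].
- move=> v d d0; have [n0 h] := ob v d d0; exists n0 => n nn; apply: h.
  by apply: leq_trans nn _; apply: leq_trans (leqnSn n) _; exact: increasing_ge.
- by lra.
- by move=> n; have [] := aP n.
have wz : wnull S z.
  apply: (@disjoint_solid_wnull _ (a \o s)) => //.
    move=> k; rewrite rabs_pos; last exact: (zx k).1.
    by apply: rle_trans (zx k).2 _; have [] := aP (s k).
  by move=> t'; apply: cA => n; have [] := aP (s (t' n)).
(* Passing to a positive part and then truncating leaves at least [e / 4]. *)
have e8 : 0 < e / 8 by lra.
have hts : {homo (fun k => t (s k).+1) : i j / (i < j)%N}.
  by move=> i j ij; apply: ht; rewrite ltnS; exact: hs.
have [k1 k1P] := bz _ z hts dz wz _ e8.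
have := k1P (maxn k0 k1) (leq_maxr _ _).
have := k0P (maxn k0 k1) (leq_maxl _ _).
lra.
Qed.

End SolidHulls.
(** * Banach lattices and their duals as normed Riesz spaces *)

Section Kantorovich.
Variables (R : realType) (V : lmodType R) (S : rieszSpace V).
Local Notation "x <=: y" := (rle S x y) (at level 70).
Local Notation N := (rnorm S).
Local Notation rabs := (rabs S).
Local Notation rpos := (rpos S).

(** The value does not depend on how [x] is written as a difference of positive elements; this is
    [hE], from which linearity follows. *)
Lemma linform_cone_ext (P : V -> R) :
  (forall x y, 0 <=: x -> 0 <=: y -> P (x + y) = P x + P y) ->
  (forall a x, 0 <= a -> 0 <=: x -> P (a *: x) = a * P x) ->
  linform (fun x => P (rpos x) - P (rpos (- x))).
Proof.
move=> PD PZ; pose h x := P (rpos x) - P (rpos (- x)).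
have p0 := rpos_ge0 S.
have hE x y z : 0 <=: y -> 0 <=: z -> x = y - z -> h x = P y - P z.
  move=> y0 z0 xyz.
  have e : rpos x + z = rpos (- x) + y.
    have -> : rpos x = (y - z) + rpos (- x).
      by rewrite -xyz -[X in _ = X + _](rposB S x) subrK.
    by rewrite addrAC subrK addrC.
  have := congr1 P e; rewrite !PD// /h; lra.
have hD x y : h (x + y) = h x + h y.
  rewrite (hE (x + y) (rpos x + rpos y) (rpos (- x) + rpos (- y))).
  - by rewrite !PD// /h; lra.
  - exact: rge0D.
  - exact: rge0D.
  - by rewrite opprD addrACA !rposB.
have hZ a x : 0 <= a -> h (a *: x) = a * h x.
  move=> a0; rewrite (hE _ (a *: rpos x) (a *: rpos (- x))).
  - by rewrite !PZ// /h; lra.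
  - exact: rge0Z.
  - exact: rge0Z.
  - by rewrite -scalerBr rposB.
have hN x : h (- x) = - h x by rewrite /h opprK; lra.
move=> a x y; rewrite -/(h _) -/(h _) -/(h _) hD; congr (_ + _).
have [a0|a0] := leP 0 a; first exact: hZ.
rewrite -[a]opprK scaleNr hN hZ; lra.
Qed.

(** The Riesz-Kantorovich formula for the positive part of [f], meant for positive [x]; [form_pos]
    is its linear extension. *)
Definition kpos (f : V -> R) (x : V) : R :=
  sup [set f y | y in [set y | 0 <=: y /\ y <=: x]].

Definition form_pos (f : V -> R) (x : V) : R :=
  kpos f (rpos x) - kpos f (rpos (- x)).

Section FormPos.
Variables (f : V -> R) (fd : rdual S f).

Lemma kpos_ge x y : 0 <=: y -> y <=: x -> f y <= kpos f x.
Proof.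
move=> y0 yx; apply: ub_le_sup; last by exists y.
have [C _ fC] := rdual_bound fd; exists (C * N x) => _ [z [z0 zx] <-].
apply: le_trans (ler_norm _) _; apply: fC.
by rewrite !rabs_pos//; exact: rle_trans zx.
Qed.

Lemma kpos_le x M : 0 <=: x ->
  (forall y, 0 <=: y -> y <=: x -> f y <= M) -> kpos f x <= M.
Proof.
move=> x0 h; apply: ge_sup; last by move=> _ [z [z0 zx] <-]; exact: h.
by exists (f 0), 0 => //; split=> //; exact: rle_refl.
Qed.

Lemma kposD x y : 0 <=: x -> 0 <=: y -> kpos f (x + y) = kpos f x + kpos f y.
Proof.
have lf := fd.1; move=> x0 y0; apply/eqP; rewrite eq_le; apply/andP; split.
  apply: kpos_le => [|z z0 zxy]; first exact: rge0D.
  (* The first summand is the infimum of [z] and [x]; the excess is at most [y]. *)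
  have -> : z = (z - rpos (z - x)) + rpos (z - x) by rewrite subrK.
  rewrite (linformD _ _ lf); apply: lerD; apply: kpos_ge.
  - apply/rsub_ge0; apply: rpos_le => //; apply/rle_subl; exact: rle_addr.
  - by apply/rle_subl; rewrite addrC; apply/rle_subl; exact: rle_pos.
  - exact: rpos_ge0.
  - by apply: rpos_le => //; apply/rle_subl; rewrite addrC.
rewrite -lerBrDr; apply: kpos_le => // y1 y10 y1x.
rewrite lerBrDr addrC -lerBrDr; apply: kpos_le => // y2 y20 y2y.
rewrite lerBrDr addrC -(linformD _ _ lf); apply: kpos_ge; first exact: rge0D.
exact: rleD.
Qed.

Lemma kposZ a x : 0 <= a -> 0 <=: x -> kpos f (a *: x) = a * kpos f x.
Proof.
have lf := fd.1; move=> + x0; rewrite le_eqVlt => /predU1P[<-|a0].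
  rewrite scale0r mul0r; apply/eqP; rewrite eq_le; apply/andP; split.
    apply: kpos_le => [|y y0 y1]; first exact: rle_refl.
    by rewrite (rle_anti y1 y0) (linform0 lf).
  by rewrite -(linform0 lf); apply: kpos_ge; exact: rle_refl.
have ia : 0 < a^-1 by rewrite invr_gt0.
apply/eqP; rewrite eq_le; apply/andP; split.
  apply: kpos_le => [|y y0 yx]; first by apply: rge0Z => //; exact: ltW.
  have -> : y = a *: (a^-1 *: y) by rewrite scalerA mulfV ?gt_eqF// scale1r.
  rewrite (linformZ _ _ lf) ler_pM2l//; apply: kpos_ge.
    by apply: rge0Z => //; exact: ltW.
  by have := rle_scale (ltW ia) yx; rewrite scalerA mulVf ?gt_eqF// scale1r.
rewrite -ler_pdivlMl//; apply: kpos_le => // y y0 yx.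
rewrite ler_pdivlMl// -(linformZ _ _ lf); apply: kpos_ge.
  by apply: rge0Z => //; exact: ltW.
by apply: rle_scale => //; exact: ltW.
Qed.

Lemma form_posE x : 0 <=: x -> form_pos f x = kpos f x.
Proof.
move=> x0; rewrite /form_pos.
have -> : rpos x = x.
  by apply: rle_anti _ (rle_pos _ _); apply: rpos_le => //; exact: rle_refl.
have -> : rpos (- x) = 0.
  apply: rle_anti _ (rpos_ge0 _ _); apply: rpos_le; last exact: rle_refl.
  by apply: rleNl; rewrite oppr0.
rewrite -(scale0r 0) kposZ ?mul0r ?subr0//; exact: rle_refl.
Qed.

Lemma form_pos_dual : rdual S (form_pos f).
Proof.
split.
  apply: linform_cone_ext => [x y|a x]; first exact: kposD.
  exact: kposZ.
have [C C0 fC] := rdual_bound fd; exists (C + C) => x.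
have le y : rabs y <=: rabs x -> `|kpos f (rpos y)| <= C * N x.
  move=> yx; have y0 := rpos_ge0 S y; rewrite ger0_norm; last first.
    rewrite -(linform0 fd.1); apply: kpos_ge => //; exact: rle_refl.
  apply: kpos_le => // z z0 zy; apply: le_trans (ler_norm _) _; apply: fC.
  rewrite (rabs_pos z0); apply: (rle_trans zy); apply: rle_trans yx.
  exact: rpos_le_abs.
rewrite mulrDl; apply: le_trans (ler_normB _ _) _; apply: lerD; apply: le.
  exact: rle_refl.
by rewrite rabsN; exact: rle_refl.
Qed.

Lemma form_pos_ge x : 0 <=: x -> f x <= form_pos f x.
Proof. by move=> x0; rewrite form_posE//; apply: kpos_ge => //; exact: rle_refl. Qed.

Lemma form_pos_ge0 x : 0 <=: x -> 0 <= form_pos f x.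
Proof.
move=> x0; rewrite form_posE// -(linform0 fd.1); apply: kpos_ge => //.
exact: rle_refl.
Qed.

End FormPos.

Lemma linform_pos_mono (f : V -> R) x y : linform f ->
  (forall z, 0 <=: z -> 0 <= f z) -> x <=: y -> f x <= f y.
Proof.
by move=> lf f0 /rsub_ge0/f0; rewrite (linformB _ _ lf) subr_ge0.
Qed.

End Kantorovich.

(** * Banach lattices *)

Section BanachLatticeAsRieszSpace.
Variables (R : realType) (E : completeNormedModType R) (L : BanachLattice E).

Lemma is_dualP (X : normedModType R) (f : X -> R) :
  is_dual f <-> linform f /\ exists C, forall x, `|f x| <= C * `|x|.
Proof.
split=> -[lf].
  move=> cf; split=> //; have : f x @[x --> 0] --> f 0 by exact: cf.
  rewrite (linform0 lf) => /cvgr0Pnorm_le/(_ 1 ltr01).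
  move=> /nbhs_norm0P[d /= d0 dP]; exists (2 / d) => x.
  have [->|x0] := eqVneq x 0; first by rewrite (linform0 lf) !normr0 mulr0.
  have nx : 0 < `|x| by rewrite normr_gt0.
  have k0 : 0 < d / 2 / `|x| by rewrite !divr_gt0.
  have := dP ((d / 2 / `|x|) *: x); rewrite /= normrZ gtr0_norm// divfK ?gt_eqF//.
  rewrite ltr_pdivrMr// ltr_pMr// (linformZ _ _ lf) normrM gtr0_norm//.
  move=> h; have {}h := h _.
  have : d / 2 / `|x| * `|f x| <= 1 by apply: h; lra.
  rewrite -ler_pdivlMl// mulr1 => /le_trans; apply.
  by rewrite !invfM !invrK [d^-1 * 2]mulrC.
move=> [C fC]; split=> // x; apply/cvgrPdist_le => e e0.
have D0 : 0 < `|C| + 1 by apply: ltr_pwDr.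
have h0 : 0 < e / (`|C| + 1) by rewrite divr_gt0.
apply/nbhs_normP; exists (e / (`|C| + 1)) => //= y /ltW xy.
rewrite -(linformB _ _ lf); apply: le_trans (fC _) _.
apply: le_trans (_ : (`|C| + 1) * `|x - y| <= _).
  by apply: ler_wpM2r => //; have := ler_norm C; lra.
by rewrite mulrC -ler_pdivlMr.
Qed.

(** The positive cone is norm closed: the negative part [m] of [x] is below the modulus of [w - x]
    for every positive [w], so its norm is arbitrarily small. *)
Lemma ble_of_approx (x : E) :
  (forall e, 0 < e -> exists2 w, ble L 0 w & `|w - x| <= e) -> ble L 0 x.
Proof.
move=> h; pose m := bjoin L (- x) 0.
have le (w : E) : ble L 0 w -> `|m| <= `|w - x|.
  move=> w0; apply: (@bnorm_mono _ _ L).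
  have m0 : ble L 0 m by exact: bjoin_ubr.
  have ad := @ble_add _ _ L.
  apply: (@ble_trans _ _ L _ m).
    apply: bjoin_lub; first exact: ble_refl.
    apply: ble_trans (m0); have := ad _ _ (- m) m0.
    by rewrite add0r subrr.
  apply: bjoin_lub.
    apply: (@ble_trans _ _ L _ (w - x)); last exact: bjoin_ubl.
    by have := ad _ _ (- x) w0; rewrite add0r.
  set a := bjoin L (w - x) _.
  have aa : ble L 0 (2 *: a).
    have h1 : ble L (w - x) a by exact: bjoin_ubl.
    have h2 : ble L (- (w - x)) a by exact: bjoin_ubr.
    have := ad _ _ (- (w - x)) h1; rewrite subrr => /ble_trans; apply.
    by rewrite addrC scaler_nat mulr2n; exact: ad.
  have hf : (0 : R) <= 2^-1 by lra.
  have := ble_scale hf aa.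
  by rewrite scaler0 scalerA mulVf// scale1r.
have m00 : m = 0.
  apply/eqP; rewrite -normr_le0; apply/ler_addgt0Pr => e /h[w w0 we].
  by rewrite add0r; exact: le_trans (le w w0) we.
have : ble L (- x) 0 by rewrite -m00; exact: bjoin_ubl.
by move=> /(ble_add x); rewrite addNr add0r.
Qed.

(** Completeness of [E] enters here: [v] is the sum of the absolutely convergent series [w], and
    [v - w n] is a limit of positive elements. *)
Lemma banach_sigma (u : nat -> E) (M : R) :
  (forall n, ble L 0 (u n)) -> (forall n, `|u n| <= M) ->
  exists v, forall n, ble L (2^-1 ^+ n *: u n) v.
Proof.
move=> u0 uM; pose w n := 2^-1 ^+ n *: u n.
have w0 n : ble L 0 (w n).
  have p : 0 <= (2^-1 : R) ^+ n by rewrite exprn_ge0.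
  by have := ble_scale p (u0 n); rewrite scaler0.
have cw : cvgn (series w).
  apply: normed_cvg; apply: nondecreasing_is_cvgn.
    by apply: nondecreasing_series => n _ _; exact: normr_ge0.
  exists (2 * M) => _ [n _ <-]; rewrite /series /=.
  apply: le_trans (_ : \sum_(0 <= i < n) 2^-1 ^+ i * M <= _).
    apply: ler_sum => i _; rewrite normrZ ger0_norm ?exprn_ge0//.
    by apply: ler_wpM2l; rewrite ?exprn_ge0.
  rewrite -mulr_suml; apply: ler_wpM2r; last first.
    by apply: geometric_half_sum; exact: iota_uniq.
  exact: le_trans (normr_ge0 _) (uM 0%N).
exists (limn (series w)) => n.
suff /(ble_add (w n)) : ble L 0 (limn (series w) - w n).
  by rewrite add0r subrK.
apply: ble_of_approx => e e0.
have /cvgrPdist_le/(_ _ e0)[m0 _ h] := cw.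
pose m := maxn m0 n.+1; exists (series w m - w n).
  rewrite /series /= (bigD1_seq n) ?iota_uniq ?mem_index_iota ?leq_maxr//=.
  rewrite addrAC subrr add0r; elim/big_ind: _ => //; first exact: ble_refl.
  move=> a b a0 b0; apply: ble_trans a0 _; have := ble_add a b0.
  by rewrite add0r addrC.
have := h m; rewrite /= leq_maxl => /(_ isT).
by rewrite distrC opprB addrA subrK.
Qed.

Lemma norm_seminorm (X : normedModType R) : seminorm (fun x : X => `|x|).
Proof. by split=> [x y|a x]; [exact: ler_normD|exact: normrZ]. Qed.

Definition banach_riesz : rieszSpace E :=
  @RieszSpace R E (ble L) (bjoin L) (fun x => `|x|) (@ble_refl _ _ L)
    (fun y x z => @ble_trans _ _ L x y z) (@ble_anti _ _ L)
    (fun z x y => @ble_add _ _ L x y z) (@ble_scale _ _ L) (@bjoin_ubl _ _ L)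
    (@bjoin_ubr _ _ L) (@bjoin_lub _ _ L) (norm_seminorm E)
    (@bnorm_mono _ _ L) banach_sigma.

Lemma banach_rdualP f : rdual banach_riesz f <-> is_dual f.
Proof. by rewrite is_dualP. Qed.

Lemma banach_wnullP x : wnull banach_riesz x <-> weakly_null x.
Proof.
split=> h f fd; first by apply/null_seqP; apply: h; exact/banach_rdualP.
by apply/null_seqP; apply: h; exact/banach_rdualP.
Qed.

Lemma banach_disjointP x : rdisjoint_seq banach_riesz x <-> disjoint_seq L x.
Proof.
have ab := rabs_ge0 banach_riesz.
split=> d i j ij.
  apply: (@ble_anti _ _ L); last by apply: bmeet_glb; exact: ab.
  by apply: (d i j ij); [exact: bmeet_lbl|exact: bmeet_lbr].
by move=> z zi zj /=; rewrite -(d i j ij); exact: bmeet_glb.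
Qed.

End BanachLatticeAsRieszSpace.

(** * The dual as a vector space with its norm *)

Section DualSpace.
Variables (R : realType) (X : normedModType R).

Definition dual_space : Type := Dual X.
HB.instance Definition _ := Choice.on dual_space.

Definition dval (w : dual_space) : X -> R := proj1_sig w.

Definition mk_dual (f : X -> R) (fd : is_dual f) : dual_space :=
  exist _ f (asboolT fd).

Lemma dval_dual (w : dual_space) : is_dual (dval w).
Proof. exact: (asboolW (proj2_sig w)). Qed.

Lemma dval_inj : injective dval.
Proof. by move=> u v uv; apply: val_inj. Qed.

Lemma is_dual0 : is_dual (fun _ : X => 0 : R).
Proof.
apply/is_dualP; split=> [a x y|]; first by rewrite mulr0 addr0.
by exists 0 => x; rewrite mul0r normr0.
Qed.

Lemma is_dualD (f g : X -> R) :
  is_dual f -> is_dual g -> is_dual (fun x => f x + g x).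
Proof.
move=> /is_dualP[lf [C fC]] /is_dualP[lg [D gD]]; apply/is_dualP.
split=> [a x y|]; first by rewrite lf lg; lra.
exists (C + D) => x; rewrite mulrDl; apply: le_trans (ler_normD _ _) _.
exact: lerD.
Qed.

Lemma is_dualZ a (f : X -> R) : is_dual f -> is_dual (fun x => a * f x).
Proof.
move=> /is_dualP[lf [C fC]]; apply/is_dualP; split=> [b x y|].
  by rewrite lf; lra.
by exists (`|a| * C) => x; rewrite normrM -mulrA ler_wpM2l.
Qed.

Definition dual_zero := mk_dual is_dual0.
Definition dual_add (u v : dual_space) :=
  mk_dual (is_dualD (dval_dual u) (dval_dual v)).
Definition dual_scale a (u : dual_space) := mk_dual (is_dualZ a (dval_dual u)).

Lemma dual_addA : associative dual_add.
Proof. by move=> u v w; apply/dval_inj/funext => x /=; rewrite addrA. Qed.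

Lemma dual_addC : commutative dual_add.
Proof. by move=> u v; apply/dval_inj/funext => x /=; rewrite addrC. Qed.

Lemma dual_add0 : left_id dual_zero dual_add.
Proof. by move=> u; apply/dval_inj/funext => x /=; rewrite add0r. Qed.

Lemma dual_addN : left_inverse dual_zero (dual_scale (-1)) dual_add.
Proof. by move=> u; apply/dval_inj/funext => x /=; rewrite mulN1r addNr. Qed.

HB.instance Definition _ := GRing.isZmodule.Build dual_space
  dual_addA dual_addC dual_add0 dual_addN.

Lemma dual_scaleA a b u : dual_scale a (dual_scale b u) = dual_scale (a * b) u.
Proof. by apply/dval_inj/funext => x /=; rewrite mulrA. Qed.

Lemma dual_scale1 : left_id 1 dual_scale.
Proof. by move=> u; apply/dval_inj/funext => x /=; rewrite mul1r. Qed.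

Lemma dual_scaleDr : right_distributive dual_scale +%R.
Proof. by move=> a u v; apply/dval_inj/funext => x /=; rewrite mulrDr. Qed.

Lemma dual_scaleDl u : {morph dual_scale^~ u : a b / a + b >-> a + b}.
Proof. by move=> a b; apply/dval_inj/funext => x /=; rewrite mulrDl. Qed.

HB.instance Definition _ := GRing.Zmodule_isLmodule.Build R dual_space
  dual_scaleA dual_scale1 dual_scaleDr dual_scaleDl.

Lemma dvalD (u v : dual_space) x : dval (u + v) x = dval u x + dval v x.
Proof. by []. Qed.

Lemma dvalZ a (u : dual_space) x : dval (a *: u) x = a * dval u x.
Proof. by []. Qed.

Lemma dvalN (u : dual_space) x : dval (- u) x = - dval u x.
Proof. by rewrite -scaleN1r dvalZ mulN1r. Qed.

Lemma dvalB (u v : dual_space) x : dval (u - v) x = dval u x - dval v x.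
Proof. by rewrite dvalD dvalN. Qed.

Lemma dval_linform (u : dual_space) : linform (dval u).
Proof. exact: (dval_dual u).1. Qed.

Lemma dnorm_has_sup (f : X -> R) : is_dual f ->
  has_sup [set `|f x| | x in [set x : X | `|x| <= 1]].
Proof.
move=> /is_dualP[lf [C fC]]; split; first by exists `|f 0|, 0 => //=; rewrite normr0.
exists `|C| => _ [x /= x1 <-]; apply: le_trans (fC x) _.
apply: le_trans (ler_wpM2r _ (ler_norm C)) _ => //.
by rewrite -[leRHS]mulr1; exact: ler_wpM2l.
Qed.

Lemma dnorm_ge0 (f : X -> R) : is_dual f -> 0 <= dnorm f.
Proof.
move=> fd; apply: le_trans (normr_ge0 (f 0)) _.
by apply: (ub_le_sup (dnorm_has_sup fd).2); exists 0 => //=; rewrite normr0.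
Qed.

Lemma dnorm_bound (f : X -> R) x : is_dual f -> `|f x| <= dnorm f * `|x|.
Proof.
move=> fd; have lf := fd.1.
have [->|x0] := eqVneq x 0; first by rewrite (linform0 lf) !normr0 mulr0.
have nx : 0 < `|x| by rewrite normr_gt0.
have ix : 0 < `|x|^-1 by rewrite invr_gt0.
rewrite -ler_pdivrMr// mulrC.
have -> : `|x|^-1 * `|f x| = `|f (`|x|^-1 *: x)|.
  by rewrite (linformZ _ _ lf) normrM gtr0_norm.
apply: (ub_le_sup (dnorm_has_sup fd).2); exists (`|x|^-1 *: x) => //=.
by rewrite normrZ gtr0_norm// mulVf ?gt_eqF.
Qed.

Lemma dnorm_le (f : X -> R) M : (forall x, `|x| <= 1 -> `|f x| <= M) ->
  dnorm f <= M.
Proof.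
move=> h; apply: ge_sup; first by exists `|f 0|, 0 => //=; rewrite normr0.
by move=> _ [x /= /h ? <-].
Qed.

Lemma dnorm_seminorm : seminorm (fun u : dual_space => dnorm (dval u)).
Proof.
have bd (u : dual_space) x : `|x| <= 1 -> `|dval u x| <= dnorm (dval u).
  move=> x1; apply: le_trans (dnorm_bound x (dval_dual u)) _.
  by rewrite -[leRHS]mulr1; apply: ler_wpM2l => //; exact/dnorm_ge0/dval_dual.
apply: seminorm_of_le => [u v|a u].
  apply: dnorm_le => x x1; apply: le_trans (ler_normD _ _) _.
  by apply: lerD; exact: bd.
by apply: dnorm_le => x x1; rewrite dvalZ normrM; apply: ler_wpM2l => //; exact: bd.
Qed.

End DualSpace.

(** * The dual as a normed Riesz space *)

Section DualLattice.
Variables (R : realType) (F : completeNormedModType R) (L : BanachLattice F).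
Local Notation S := (banach_riesz L).
Local Notation D := (dual_space F).

Definition dual_le (u v : D) : Prop :=
  forall x, ble L 0 x -> dval u x <= dval v x.

Lemma form_pos_is_dual (u : D) : is_dual (form_pos S (dval u)).
Proof. by apply/(banach_rdualP L)/form_pos_dual/banach_rdualP/dval_dual. Qed.

Definition dual_pos (u : D) : D := mk_dual (form_pos_is_dual u).

Definition dual_join (u v : D) : D := u + dual_pos (v - u).

Lemma dval_rdual (u : D) : rdual S (dval u).
Proof. exact/banach_rdualP/dval_dual. Qed.

Lemma dual_le_refl u : dual_le u u. Proof. by move=> x _. Qed.

Lemma dual_le_trans v u w : dual_le u v -> dual_le v w -> dual_le u w.
Proof. by move=> uv vw x x0; exact: le_trans (uv x x0) (vw x x0). Qed.

Lemma dual_le_anti u v : dual_le u v -> dual_le v u -> u = v.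
Proof.
move=> uv vu; apply/dval_inj/funext => x.
have e y : ble L 0 y -> dval u y = dval v y.
  by move=> y0; apply/eqP; rewrite eq_le uv// vu.
rewrite -(rposB S x) !(linformB _ _ (dval_linform _)).
by rewrite !e//; exact: (rpos_ge0 S).
Qed.

Lemma dual_le_add w u v : dual_le u v -> dual_le (u + w) (v + w).
Proof. by move=> uv x x0; rewrite !dvalD lerD2r; exact: uv. Qed.

Lemma dual_le_scale a u v : 0 <= a -> dual_le u v -> dual_le (a *: u) (a *: v).
Proof. by move=> a0 uv x x0; rewrite !dvalZ; apply: ler_wpM2l => //; exact: uv. Qed.

Lemma dual_join_ubl u v : dual_le u (dual_join u v).
Proof.
move=> x x0; rewrite dvalD lerDl; apply: (@form_pos_ge0 _ _ S) => //.
exact: dval_rdual.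
Qed.

Lemma dual_join_ubr u v : dual_le v (dual_join u v).
Proof.
move=> x x0; rewrite dvalD -lerBlDl -dvalB.
by apply: (@form_pos_ge _ _ S) => //; exact: dval_rdual.
Qed.

Lemma dual_join_lub u v w : dual_le u w -> dual_le v w -> dual_le (dual_join u v) w.
Proof.
move=> uw vw x x0; rewrite dvalD -lerBrDl.
rewrite -[leLHS]/(form_pos S (dval (v - u)) x) form_posE//; last exact: dval_rdual.
apply: kpos_le => // y y0 yx; rewrite -dvalB.
apply: le_trans (_ : dval (w - u) y <= _).
  by rewrite !dvalB lerD2r; exact: vw.
apply: (@linform_pos_mono _ _ S) => // [|z z0]; first exact: dval_linform.
by rewrite dvalB subr_ge0; exact: uw.
Qed.

Lemma dabs_has_sup (f : F -> R) x : is_dual f -> ble L 0 x ->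
  has_sup [set `|f z| | z in [set z : F | ble L (babs L z) x]].
Proof.
move=> fd x0; split.
  by exists `|f 0|, 0 => //=; rewrite -[babs L 0]/(rabs S 0) rabs0.
have [C _ fC] := rdual_bound (proj2 (banach_rdualP L f) fd).
exists (C * `|x|) => _ [z /= zx <-]; apply: (fC z x).
by rewrite (rabs_pos (S := S) x0).
Qed.

(** Identifies the supremum over [|z| <= x] with the join of [u] and [- u], so that [dabs] is the
    modulus of [dual_riesz]. *)
Lemma dabsE (u : D) x : ble L 0 x -> dabs L (dval u) x = dval (dual_join u (- u)) x.
Proof.
move=> x0; have lu := dval_linform u.
apply/eqP; rewrite eq_le; apply/andP; split.
  apply: ge_sup; first exact: (dabs_has_sup (dval_dual u) x0).1.
  move=> _ [z /= zx <-]; set a := dual_join u (- u).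
  have a0 y : ble L 0 y -> 0 <= dval a y.
    move=> y0; have := dual_join_ubl u (- u) y0; have := dual_join_ubr u (- u) y0.
    rewrite dvalN -/a; lra.
  apply: le_trans (_ : dval a (rabs S z) <= _); last first.
    by apply: (@linform_pos_mono _ _ S) => //; exact: dval_linform.
  rewrite rabsE (linformD _ _ (dval_linform _)) -{1}(rposB S z).
  rewrite (linformB _ _ lu); apply: le_trans (ler_normB _ _) _.
  have le y : ble L 0 y -> `|dval u y| <= dval a y.
    move=> y0; rewrite ler_norml; have := dual_join_ubl u (- u) y0.
    have := dual_join_ubr u (- u) y0; rewrite dvalN -/a; lra.
  by apply: lerD; apply: le; exact: (rpos_ge0 S).
rewrite dvalD -lerBrDl -[leLHS]/(form_pos S (dval (- u - u)) x).
rewrite form_posE//; last exact: dval_rdual.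
apply: kpos_le => // y y0 yx; rewrite lerBrDl.
(* For [0 <= y <= x] the element [x - (y + y)] has modulus at most [x], and [u] takes there the
   value to be bounded. *)
apply: le_trans (_ : `|dval u (x - (y + y))| <= _).
  rewrite dvalB dvalN (linformB _ _ lu) (linformD _ _ lu).
  by apply: le_trans (ler_norm _); lra.
apply: (ub_le_sup (dabs_has_sup (dval_dual u) x0).2).
exists (x - (y + y)) => //=; apply: (@rabs_le _ _ S).
  by apply/(rle_subl S)/(rle_addr _ (S := S)); exact: (rge0D (S := S)).
rewrite opprB; apply/(rle_subl S); exact: (rleD (S := S)).
Qed.

Lemma dual_norm_mono u v :
  dual_le (dual_join u (- u)) (dual_join v (- v)) ->
  dnorm (dval u) <= dnorm (dval v).
Proof.
move=> uv; apply: dnorm_le => x x1.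
have ax : ble L 0 (babs L x) by exact: (rabs_ge0 S).
apply: le_trans (_ : dabs L (dval u) (babs L x) <= _).
  apply: (ub_le_sup (dabs_has_sup (dval_dual u) ax).2).
  by exists x => //=; exact: ble_refl.
rewrite dabsE//; apply: le_trans (uv _ ax) _; rewrite -dabsE//.
apply: ge_sup; first exact: (dabs_has_sup (dval_dual v) ax).1.
move=> _ [z /= zx <-]; apply: le_trans (dnorm_bound z (dval_dual v)) _.
rewrite -[leRHS]mulr1; apply: ler_wpM2l; first exact/dnorm_ge0/dval_dual.
by apply: le_trans x1; exact: (bnorm_mono zx).
Qed.

(** The pointwise sum of the series is a bounded form, and on positive elements it exceeds each of
    its terms. *)
Lemma dual_sigma (u : nat -> D) (M : R) :
  (forall n, dual_le 0 (u n)) -> (forall n, dnorm (dval (u n)) <= M) ->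
  exists v, forall n, dual_le (2^-1 ^+ n *: u n) v.
Proof.
move=> u0 uM.
have sg : summable_forms S (fun n x => 2^-1 ^+ n * dval (u n) x).
  apply: (@summable_geometric _ _ _ _ M) => [n|n x]; first exact: dval_linform.
  apply: le_trans (dnorm_bound x (dval_dual _)) _.
  by apply: ler_wpM2r => //; exact: normr_ge0.
have [h hd hP] := summable_forms_sum sg.
exists (mk_dual (proj1 (banach_rdualP L h) hd)) => n x x0.
rewrite dvalZ; apply/ler_addgt0Pr => e e0.
have [m0 m0P] := hP x e e0.
have := m0P (maxn m0 n.+1) (leq_maxl _ _).
rewrite ler_norml (bigD1_seq n) ?iota_uniq ?mem_index_iota ?leq_maxr//=.
set T := \sum_(_ <- _ | _) _.
have : 0 <= T.
  apply: sumr_ge0 => i _; apply: mulr_ge0; first by rewrite exprn_ge0.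
  exact: (u0 i x x0).
lra.
Qed.

Definition dual_riesz : rieszSpace D :=
  @RieszSpace R D dual_le dual_join (fun u => dnorm (dval u)) dual_le_refl
    dual_le_trans dual_le_anti dual_le_add dual_le_scale dual_join_ubl
    dual_join_ubr dual_join_lub (dnorm_seminorm F) dual_norm_mono dual_sigma.

Lemma dual_rabsE (u : D) x : ble L 0 x -> dval (rabs dual_riesz u) x = dabs L (dval u) x.
Proof. by move=> x0; rewrite dabsE. Qed.

Lemma dual_disjP (u v : D) :
  rdisj dual_riesz (rabs dual_riesz u) (rabs dual_riesz v) <->
  ddisjoint L (dval u) (dval v).
Proof.
pose a := rabs dual_riesz u; pose b := rabs dual_riesz v.
have setE x : ble L 0 x ->
    [set dabs L (dval u) y + dabs L (dval v) (x - y) |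
      y in [set y : F | ble L 0 y /\ ble L y x]] =
    [set dval a y + dval b (x - y) | y in [set y : F | ble L 0 y /\ ble L y x]].
  by move=> x0; apply: eq_imagel => y [y0 yx]; rewrite !dual_rabsE//; exact/(rsub_ge0 S).
have a0 x : ble L 0 x -> 0 <= dval a x by exact: (rabs_ge0 dual_riesz u).
have b0 x : ble L 0 x -> 0 <= dval b x by exact: (rabs_ge0 dual_riesz v).
have lb x : has_lbound
    [set dval a y + dval b (x - y) | y in [set y : F | ble L 0 y /\ ble L y x]].
  exists 0 => _ [y [y0 yx] <-]; apply: addr_ge0; first exact: a0.
  by apply: b0; exact/(rsub_ge0 S).
split=> [d x x0|d z za zb x x0].
  rewrite setE//; apply/eqP; rewrite eq_le; apply/andP; split; last first.
    apply: lb_le_inf.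
      by exists (dval a 0 + dval b (x - 0)), 0 => //; split=> //; exact: ble_refl.
    move=> _ [y [y0 yx] <-]; apply: addr_ge0; first exact: a0.
    by apply: b0; exact/(rsub_ge0 S).
  (* [m] is the infimum of [a] and [b]; its value at [x] is at least the infimum in [ddisjoint]. *)
  pose m := b - dual_pos (b - a).
  have ma : dual_le m a.
    move=> y y0; rewrite dvalB lerBlDr -lerBlDl -dvalB.
    by apply: (@form_pos_ge _ _ S) => //; exact: dval_rdual.
  have mb : dual_le m b.
    move=> y y0; rewrite dvalB lerBlDr lerDl.
    by apply: (@form_pos_ge0 _ _ S) => //; exact: dval_rdual.
  apply: le_trans (d m ma mb x x0).
  rewrite dvalB lerBrDr addrC -lerBrDr.
  rewrite -[leLHS]/(form_pos S (dval (b - a)) x) form_posE//; last exact: dval_rdual.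
  apply: kpos_le => // y y0 yx; rewrite lerBrDr addrC -lerBrDr.
  apply: ge_inf => //; exists y => //.
  rewrite dvalB (linformB _ _ (dval_linform b)); lra.
rewrite -[leRHS](d x x0) setE//.
apply: lb_le_inf.
  by exists (dval a 0 + dval b (x - 0)), 0 => //; split=> //; exact: ble_refl.
move=> _ [y [y0 yx] <-].
have -> : dval z x = dval z y + dval z (x - y).
  by rewrite -(linformD _ _ (dval_linform z)) addrCA subrr addr0.
by apply: lerD; [exact: za|apply: zb; exact/(rsub_ge0 S)].
Qed.

Lemma bidual_rdual phi : is_bidual phi -> rdual dual_riesz (fun u => phi (dval u)).
Proof.
move=> [lphi [C phiC]]; split=> [a u v|]; first by apply: lphi; exact: dval_dual.
by exists C => u; apply: phiC; exact: dval_dual.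
Qed.

Lemma rdual_bidual (g : D -> R) : rdual dual_riesz g ->
  exists2 phi, is_bidual phi & forall u, phi (dval u) = g u.
Proof.
move=> [lg [C gC]].
(* [is_bidual] concerns functionals on all functions; [0] is a default value outside the dual. *)
pose phi f := if pselect (is_dual f) is left fd then g (mk_dual fd) else 0.
have phiE u : phi (dval u) = g u.
  rewrite /phi; case: pselect => [fd|]; last by have := dval_dual u.
  by congr g; exact: dval_inj.
exists phi => //; split=> [a f h fd hd|].
  rewrite -[f]/(dval (mk_dual fd)) -[h]/(dval (mk_dual hd)) !phiE -lg -phiE.
  by congr phi.
by exists C => f fd; rewrite -[f]/(dval (mk_dual fd)) phiE; exact: gC.
Qed.

Lemma dual_wnullP (u : nat -> D) :
  wnull dual_riesz u <-> weakly_null' (fun n => dval (u n)).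
Proof.
split=> [h|[_ h] g /rdual_bidual[phi pb pg]].
  split=> [n|phi pb]; first exact: dval_dual.
  by apply/null_seqP; exact: h (bidual_rdual pb).
have /null_seqP := h phi pb.
by move=> hn e e0; have [n0 n0P] := hn e e0; exists n0 => n /n0P; rewrite pg.
Qed.

End DualLattice.
(** * Weak compactness *)

Section InitialTopology.
Variables (R : realType) (T I : choiceType) (ev : T -> {ptws I -> R}).
Local Notation X := (initial_topology ev).

Lemma initial_coord_continuous (i : I) : continuous (fun x : X => ev x i : R).
Proof.
move=> x; apply: (@continuous_comp X {ptws I -> R} R ev (fun h => h i)).
  exact: initial_continuous.
exact: (@proj_continuous I (fun=> R) i).
Qed.

Lemma initial_compact_cluster (K : set X) (a : nat -> X) :
  compact K -> (forall n, K (a n)) ->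
  exists z : X, forall (idx : nat -> I) m n0 (e : R), 0 < e ->
    exists2 n, (n0 <= n)%N &
      forall i, (i < m)%N -> `|ev (a n) (idx i) - ev z (idx i)| <= e.
Proof.
move=> cK aK; have aKn : (a @ \oo) K by exists 0%N => // n _; exact: aK.
have [z [_ cz]] := cK (a @ \oo) _ aKn; exists z => idx m n0 e e0.
have nz : nbhs z [set x : X | forall i, (i < m)%N ->
    `|ev x (idx i) - ev z (idx i)| <= e].
  elim: m => [|m IH]; first exact: filterE.
  have /cvgrPdistC_le/(_ _ e0) h := @initial_coord_continuous (idx m) z.
  near=> x => i; rewrite ltnS leq_eqVlt => /predU1P[->|].
    by near: x; exact: h.
  by move: i; near: x.
have an : (a @ \oo) [set a n | n in [set n | (n0 <= n)%N]].
  by exists n0 => // n /= nn; exists n.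
have [_ [[n nn <-] h]] := cz _ _ an nz.
by exists n.
Unshelve. all: by end_near. Qed.

Lemma initial_hausdorff : (forall x y, (forall i, ev x i = ev y i) -> x = y) ->
  hausdorff_space X.
Proof.
move=> sep p q pq; apply: sep => i; apply: (@Rhausdorff R) => A B nA nB.
have [x [Ax Bx]] := pq _ _ (@initial_coord_continuous i p _ nA)
  (@initial_coord_continuous i q _ nB).
by exists (ev x i).
Qed.

Lemma initial_cvg (a : nat -> T) (l : T) :
  (forall i, (fun n => ev (a n) i) @ \oo --> (ev l i : R)) ->
  (a : nat -> X) @ \oo --> (l : X).
Proof.
move=> al A /= [_ [[B Bop <-] Bl sBA]].
have cv : {ptws, (ev \o a) @ \oo --> ev l}.
  apply/cvg_sup => i C /= [_ [[U Uop <-] Ul sUC]].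
  have nU : nbhs (ev l i : R) U by rewrite nbhsE; exists U.
  by have [N _ NP] := al i _ nU; exists N => // n Nn; apply: sUC; exact: NP.
have nB : nbhs (ev l) B by rewrite nbhsE; exists B.
by have [N _ NP] := cv _ nB; exists N => // n Nn; apply: sBA; exact: NP.
Qed.

End InitialTopology.

(** The range together with the limit is compact, hence closed in a Hausdorff space, and so contains
    the closure of the range. *)
Lemma cvg_seq_compact (X : topologicalType) (a : nat -> X) (l : X) :
  hausdorff_space X -> a @ \oo --> l -> compact (closure (range a)).
Proof.
move=> hX al; pose K := range a `|` [set l].
have cK : compact K.
  move=> F PF FK; apply: contrapT => nK.
  have [cl|] := pselect (cluster F l); first by apply: nK; exists l; split=> //; right.
  (* If [l] is not a cluster point of [F], some member of [F] misses a neighbourhood of [l], so [F]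
     contains a finite set of terms. *)
  move=> /existsNP[A /existsNP[B /not_implyP[FA /not_implyP[nB nAB]]]].
  have [N _ NP] := al _ nB.
  have cI : compact (a @` `I_N).
    by apply: finite_compact; apply: finite_image; exact: finite_II.
  have FI : F (a @` `I_N).
    apply: filterS (filterI FA FK) => x [Ax [[n _ nx]|/= xl]].
      have [nN|Nn] := ltnP n N; first by exists n.
      by exfalso; apply: nAB; exists x; split=> //; rewrite -nx; exact: NP.
    by exfalso; apply: nAB; exists x; split=> //; rewrite xl; exact: nbhs_singleton.
  have [p [[n _ np] cp]] := cI F PF FI.
  by apply: nK; exists p; split=> //; left; exists n.
apply: (subclosed_compact (@closed_closure _ _) cK).
have /closure_id -> := compact_closed hX cK.
by apply: closureS => x; left.
Qed.

(** * Weak compactness in a Banach lattice and in its dual *)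

Section WeakCompactness.
Variables (R : realType) (E : completeNormedModType R) (L : BanachLattice E).

Lemma rel_weakly_compact_cluster (A : set E) :
  rel_weakly_compact A -> weakly_cluster_compact (banach_riesz L) A.
Proof.
move=> cA a aA.
have [|z zP] := @initial_compact_cluster _ _ _ (@wev R E) _ a cA.
  by move=> n; apply: (@subset_closure (weakE E)); exact: aA.
exists z => g m n0 e gd e0.
exact: (zP (fun i => mk_dual (proj1 (banach_rdualP L _) (gd i)))).
Qed.

Lemma rel_weakly_compact'_cluster (B : set (E -> R)) : rel_weakly_compact' B ->
  weakly_cluster_compact (dual_riesz L) [set u | B (dval u)].
Proof.
move=> [_ cB] a aB.
have [|z zP] := @initial_compact_cluster _ _ _ (@wev' R E) _ a cB.
  by move=> n; apply: (@subset_closure (weakE' E)); exact: aB.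
exists z => g m n0 e gd e0.
have [phi phiP] := choice (fun i => proj1 (exists2P _ _) (rdual_bidual (gd i))).
have [n nn h] := zP (fun i => exist _ (phi i) (asboolT (phiP i).1)) m n0 e e0.
by exists n => // i im; rewrite -!(phiP i).2; exact: h.
Qed.

(** The weak topology is Hausdorff because norming forms separate points. *)
Lemma weakly_null_compact (x : nat -> E) :
  weakly_null x -> rel_weakly_compact (range x).
Proof.
move=> wx; apply: (@cvg_seq_compact (weakE E) x 0).
  apply: initial_hausdorff => a b ab; apply/eqP; rewrite -subr_eq0 -normr_le0.
  have [g [lg gq <-]] := hahn_banach1 (a - b) (norm_seminorm E).
  have gd : is_dual g by apply/is_dualP; split=> //; exists 1 => y; rewrite mul1r.
  have := ab (mk_dual gd); rewrite /wev /= (linformB _ _ lg) => ->.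
  by rewrite subrr.
apply: initial_cvg => f; have fd := dval_dual f.
have -> : wev 0 f = 0 :> R by exact: (linform0 fd.1).
exact: (wx _ fd).
Qed.

Lemma weakly_null'_compact (f : nat -> E -> R) :
  weakly_null' f -> rel_weakly_compact' (range f).
Proof.
move=> [fd wf]; split; first by move=> _ [n _ <-].
have -> : [set u : Dual E | range f (proj1_sig u)] =
    range (fun n => mk_dual (fd n)).
  apply/seteqP; split=> [u [n _ nu]|_ [n _ <-]]; last by exists n.
  by exists n => //; apply: dval_inj.
apply: (@cvg_seq_compact (weakE' E) (fun n => mk_dual (fd n)) (0 : dual_space E)).
  apply: initial_hausdorff => u v uv; apply: dval_inj; apply/funext => x.
  have evb : is_bidual (fun f : E -> R => f x).
    split=> //; exists `|x| => g gd; rewrite mulrC; exact: dnorm_bound.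
  pose p : Bidual E := exist _ (fun f : E -> R => f x) (asboolT evb).
  by have := uv p; rewrite /wev' /=.
apply: initial_cvg => phi; have phib := asboolW (proj2_sig phi).
have phi0 : proj1_sig phi (dval (0 : dual_space E)) = 0.
  exact: (linform0 (bidual_rdual L phib).1).
have -> : wev' (0 : dual_space E) phi = 0 :> R by exact: phi0.
exact: (wf _ phib).
Qed.

End WeakCompactness.
(** * Order bounded operators *)

Lemma sup_abs_le (R : realType) (Y : Type) (A : set Y) (h : Y -> R) (e : R) :
  0 <= e -> (forall y, A y -> `|h y| <= e) -> `|sup [set `|h y| | y in A]| <= e.
Proof.
move=> e0 hA; have [[y Ay]|A0] := pselect (exists y, A y); last first.
  (* The supremum of the empty set is [0] by convention. *)
  have -> : [set `|h y| | y in A] = set0.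
    by apply/seteqP; split=> // t [y Ay _]; apply: A0; exists y.
  by rewrite sup0 normr0.
rewrite ger0_norm.
  apply: ge_sup; first by exists `|h y|, y.
  by move=> _ [z Az <-]; exact: hA.
apply: le_trans (normr_ge0 (h y)) _; apply: ub_le_sup; last by exists y.
by exists e => _ [z Az <-]; exact: hA.
Qed.

Section SubsetSup.
Variables (R : realType) (E : completeNormedModType R) (L : BanachLattice E).

Lemma norm_bounded_sup_ge (A : set E) (f : E -> R) y :
  norm_bounded A -> is_dual f -> A y -> `|f y| <= sup [set `|f z| | z in A].
Proof.
move=> [M AM] fd Ay; apply: ub_le_sup; last by exists y.
exists (dnorm f * M) => _ [z Az <-]; apply: le_trans (dnorm_bound z fd) _.
by apply: ler_wpM2l; [exact: dnorm_ge0|exact: AM].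
Qed.

Lemma norm_bounded'_sup_ge (B : set (E -> R)) (x : E) g :
  B `<=` @is_dual R E -> norm_bounded' B -> B g ->
  `|g x| <= sup [set `|h x| | h in B].
Proof.
move=> Bd [M BM] Bg; apply: ub_le_sup; last by exists g.
exists (M * `|x|) => _ [h Bh <-]; apply: le_trans (dnorm_bound x (Bd _ Bh)) _.
by apply: ler_wpM2r => //; exact: BM.
Qed.

Lemma almost_DP_set_sub (A B : set E) :
  A `<=` B -> almost_DP_set L B -> almost_DP_set L A.
Proof.
move=> AB [bB hB]; split.
  by have [M BM] := bB; exists M => y /AB; exact: BM.
move=> f df wf; apply/null_seqP => e e0.
have /null_seqP/(_ e e0)[n0 n0P] := hB f df wf.
exists n0 => n nn; apply: sup_abs_le => [|y /AB By]; first exact: ltW.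
apply: le_trans (norm_bounded_sup_ge bB (wf.1 n) By) _.
exact: le_trans (ler_norm _) (n0P n nn).
Qed.

Lemma almost_L_set_sub (A B : set (E -> R)) :
  A `<=` B -> almost_L_set L B -> almost_L_set L A.
Proof.
move=> AB [dB [bB hB]]; split; first by move=> g /AB/dB.
split; first by have [M BM] := bB; exists M => y /AB; exact: BM.
move=> x dx wx; apply/null_seqP => e e0.
have /null_seqP/(_ e e0)[n0 n0P] := hB x dx wx.
exists n0 => n nn; apply: sup_abs_le => [|g /AB Bg]; first exact: ltW.
apply: le_trans (norm_bounded'_sup_ge (x n) dB bB Bg) _.
exact: le_trans (ler_norm _) (n0P n nn).
Qed.

(** A sum of moduli is the least upper bound of the signed sums. In the induction the last signed
    term moves to the right-hand side. *)
Lemma rsign_sum_le (u : nat -> E) (y : E) n :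
  (forall s : nat -> bool, ble L (\sum_(0 <= i < n) ((-1) ^+ s i : R) *: u i) y) ->
  ble L (\sum_(0 <= i < n) babs L (u i)) y.
Proof.
pose S := banach_riesz L.
elim: n y => [|n IH] y h; first by have := h (fun=> false); rewrite !big_geq.
rewrite big_nat_recr//=; apply/(rle_subr S); apply: IH => s.
have bnd (b : bool) :
    ble L (\sum_(0 <= i < n) ((-1) ^+ s i : R) *: u i + ((-1) ^+ b : R) *: u n) y.
  have := h (fun i => if i == n then b else s i).
  rewrite big_nat_recr//= eqxx; congr (ble L (_ + _) _).
  by apply: eq_big_nat => i /andP[_ lt]; rewrite ltn_eqF.
apply/(rle_subr S); rewrite addrC; apply/(rle_subr S).
apply: (@rabs_le _ _ S); apply/(rle_subr S); rewrite addrC.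
  by have := bnd false; rewrite expr0 scale1r.
by have := bnd true; rewrite expr1 scaleN1r.
Qed.

End SubsetSup.

Lemma null_seq_comp (R : realType) (u : nat -> R) (t : nat -> nat) :
  {homo t : i j / (i < j)%N} -> null_seq u -> null_seq (u \o t).
Proof.
move=> ht nu e e0; have [n0 h] := nu e e0; exists n0 => n nn; apply: h.
exact: leq_trans nn (increasing_ge _ ht).
Qed.

Lemma increasing_neq (t : nat -> nat) i j :
  {homo t : i j / (i < j)%N} -> i <> j -> t i <> t j.
Proof.
by move=> ht ij e; have [/ht|/ht|//] := ltngtP i j; rewrite e ltnn.
Qed.

(** * The implications for an order bounded operator *)

Section OrderBoundedOperator.
Variables (R : realType) (E F : completeNormedModType R).
Variables (LE : BanachLattice E) (LF : BanachLattice F).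
Variables (T : {linear E -> F}) (Tcont : continuous T).
Hypothesis Tob : order_bounded LE LF T.
Local Notation SE := (banach_riesz LE).
Local Notation SF := (banach_riesz LF).
Local Notation DF := (dual_riesz LF).

Lemma operator_bound : exists2 C, 0 <= C & forall x, `|T x| <= C * `|x|.
Proof.
have /linear_bounded_continuous/linear_boundedP/pinfty_ex_gt0[C C0 h] := Tcont.
by exists C => //; exact: ltW.
Qed.

Lemma adjoint_linform f : linform f -> linform (fun x => f (T x)).
Proof. by move=> lf a x y; rewrite linearP lf. Qed.

(** The upper bound [d] of the image of the interval from [- v] to [v] bounds moduli as well, since
    the interval is symmetric. If [v] is not positive the interval is empty and [0] serves. *)
Lemma order_interval_image v : exists d, ble LF 0 d /\
  forall z, ble LE (babs LE z) v -> ble LF (babs LF (T z)) d.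
Proof.
have [c [d cd]] := Tob (- v) v.
have [v0|v0] := pselect (ble LE 0 v); last first.
  exists 0; split=> [|z zv]; first exact: ble_refl.
  by exfalso; apply: v0; exact: (rle_trans (r := SE) (rabs_ge0 SE z) zv).
have up z : ble LE (babs LE z) v -> ble LF (T z) d.
  move=> zv; apply: (cd z _ _).2.
    apply: (rleNl (S := SE)); exact: (rle_trans (r := SE) (rleN_abs SE z) zv).
  exact: (rle_trans (r := SE) (rle_abs SE z) zv).
exists d; split.
  by have := up 0; rewrite linear0 -[babs LE 0]/(rabs SE 0) rabs0; exact.
move=> z zv; apply: (@rabs_le _ _ SF); first exact: up.
rewrite -linearN; apply: up; rewrite -[babs LE _]/(rabs SE _) rabsN; exact: zv.
Qed.

(** Evaluating the modulus at [d] is a monotone seminorm on the dual, to which [wnull_dominated]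
    applies. *)
Lemma disjoint_modulus_null (u : nat -> dual_space F) d :
  rdisjoint_seq DF u -> wnull DF u -> ble LF 0 d ->
  null_seq (fun n => dabs LF (dval (u n)) d).
Proof.
move=> du wu d0.
pose q w := dval (rabs DF w) d.
have le (v w : dual_space F) : rle DF v w -> dval v d <= dval w d by move=> /(_ _ d0).
have ld : linform (fun w : dual_space F => dval w d) by [].
apply: (@wnull_dominated _ _ DF u q) => // [|n c].
  split; last by move=> v w vw; exact: le.
  split=> [v w|a w]; first by have := le _ _ (rabsD DF v w); rewrite dvalD.
  by rewrite /q rabsZ dvalZ.
apply: le_trans (le _ _ (rdisj_sum_abs c n du)).
rewrite (linform_sum (index_iota 0 n) (fun i => `|c i| *: rabs DF (u i)) ld).
apply: ler_sum => i _; rewrite dvalZ -dual_rabsE//; apply: ler_wpM2r.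
  exact: (rabs_ge0 DF).
exact: ler_norm.
Qed.

Lemma dual_abs_le (u : dual_space F) y :
  `|dval u y| <= dval (rabs DF u) (babs LF y).
Proof.
have y0 : ble LF 0 (babs LF y) by exact: (rabs_ge0 SF).
rewrite dual_rabsE//; apply: (ub_le_sup (dabs_has_sup (dval_dual u) y0).2).
by exists y => //; exact: ble_refl.
Qed.

Lemma disjoint_image_modulus_null (x : nat -> E) (v : dual_space F) :
  rdisjoint_seq SE x -> wnull SE x -> rle DF 0 v ->
  null_seq (fun n => dval v (babs LF (T (x n)))).
Proof.
move=> dx wx v0.
have lv := dval_linform v.
have vmono y y' : ble LF y y' -> dval v y <= dval v y'.
  by apply: (@linform_pos_mono _ _ SF).
(* Upper bounds of the image of an order interval replace [|T| |w|], as the modulus of [T] need not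
   exist. *)
pose U w := [set y | forall z, ble LE (babs LE z) (babs LE w) -> ble LF (T z) y].
have U0 w : U w !=set0.
  have [d [_ dP]] := order_interval_image (babs LE w).
  exists d => z /dP; apply: (rle_trans (r := SF)); exact: (rle_abs SF).
have Uge w y : U w y -> 0 <= dval v y.
  move=> Uy; rewrite -(linform0 lv); apply: (vmono _ _); rewrite -(linear0 T).
  apply: Uy; rewrite -[babs LE 0]/(rabs SE 0) rabs0; exact: (rabs_ge0 SE).
pose q w := inf [set dval v y | y in U w].
have qle w y : U w y -> q w <= dval v y.
  move=> Uy; apply: ge_inf; last by exists y.
  by exists 0 => _ [y' /Uge ? <-].
have qge w M : (forall y, U w y -> M <= dval v y) -> M <= q w.
  move=> h; apply: lb_le_inf; last by move=> _ [y /h ? <-].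
  by have [y Uy] := U0 w; exists (dval v y), y.
apply: (@wnull_dominated _ _ SE x q) => // [|n c]; first split.
- apply: seminorm_of_le => [w w'|a w].
    rewrite -lerBlDr; apply: (qge _ _) => y Uy; rewrite lerBlDr -lerBlDl.
    apply: (qge _ _) => y' Uy'; rewrite lerBlDl -(linformD _ _ lv).
    apply: (qle _ _) => z zw.
    (* Riesz decomposition shows that a member of [U w] plus a member of [U w'] is in
       [U (w + w')]. *)
    have [z1 [z2 [-> h1 h2 _]]] := riesz_decomposition (rabs_ge0 SE w)
      (rabs_ge0 SE w') (rle_trans (r := SE) zw (rabsD SE w w')).
    by rewrite linearD; apply: (rleD (S := SF)); [exact: Uy|exact: Uy'].
  have [->|a0] := eqVneq a 0.
    rewrite normr0 mul0r scale0r -(linform0 lv); apply: (qle _ _) => z.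
    rewrite -[babs LE 0]/(rabs SE 0) rabs0 => /(rabs_le0 (S := SE)) ->.
    rewrite linear0; exact: ble_refl.
  have na : 0 < `|a| by rewrite normr_gt0.
  rewrite -ler_pdivrMl//; apply: (qge _ _) => y Uy.
  rewrite ler_pdivrMl// -(linformZ _ _ lv); apply: (qle _ _) => z zw.
  have -> : z = `|a| *: (`|a|^-1 *: z) by rewrite scalerA mulfV ?gt_eqF// scale1r.
  rewrite linearZ; apply: ble_scale; first exact: ltW.
  apply: Uy; have ia : 0 <= `|a|^-1 by rewrite invr_ge0.
  have := rle_scale (r := SE) ia zw.
  rewrite -[babs LE (a *: w)]/(rabs SE _) rabsZ scalerA mulVf ?gt_eqF// scale1r.
  by rewrite -[babs LE (_ *: z)]/(rabs SE _) rabsZ (ger0_norm ia).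
- move=> w w' ww'; apply: (qge _ _) => y Uy; apply: (qle _ _) => z zw; apply: Uy.
  exact: (rle_trans (r := SE) zw).
- apply: (qge _ _) => y Uy.
  apply: le_trans (_ : \sum_(0 <= i < n) dval v (babs LF (T (c i *: x i))) <= _).
    apply: ler_sum => i _; rewrite linearZ -[babs LF (_ *: _)]/(rabs SF _) rabsZ.
    rewrite (linformZ _ _ lv); apply: ler_wpM2r; last exact: ler_norm.
    by rewrite -(linform0 lv); apply: (vmono _ _); exact: (rabs_ge0 SF).
  (* By [rsign_sum_le] it suffices to bound signed sums. Each is the image of an element whose
     modulus, by disjointness of [x], is at most that of [\sum c i *: x i]. *)
  rewrite -(linform_sum _ _ lv); apply: (vmono _ _); apply: rsign_sum_le => s.
  have -> : \sum_(0 <= i < n) ((-1) ^+ s i : R) *: T (c i *: x i) =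
      T (\sum_(0 <= i < n) ((-1) ^+ s i : R) *: (c i *: x i)).
    by rewrite linear_sum; apply: eq_bigr => i _; rewrite [RHS]linearZ.
  apply: Uy; apply: (rle_trans (r := SE)) (rdisj_sum_abs c n dx).
  apply: (rle_trans (r := SE)) (rabs_sum SE _ _) _.
  under eq_bigr do rewrite !rabsZ normr_sign scale1r.
  exact: rle_refl.
Qed.

(** [solid_hull_uniform_null] on [E] with the forms [f n] composed with [T]. They are order null
    because [T] sends order intervals into order intervals, where [|f n|] is small. *)
Lemma almost_weak_DP_set (A : set E) : almost_weak_DP LE LF T ->
  rel_weakly_compact A -> almost_DP_set LF (T @` sol LE A).
Proof.
move=> DP /(rel_weakly_compact_cluster LE) cA; split.
  have [M AM] := weakly_cluster_compact_bounded cA.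
  have [C C0 TC] := operator_bound.
  exists (C * M) => _ [x [a Aa xa] <-]; apply: le_trans (TC x) _.
  by apply: ler_wpM2l => //; apply: le_trans (AM _ Aa); exact: (bnorm_mono xa).
move=> f df wf; apply/null_seqP => e e0.
pose u n : dual_space F := mk_dual (wf.1 n).
have du : rdisjoint_seq DF u by move=> i j ij; apply/dual_disjP; exact: df.
have wu : wnull DF u by apply/(dual_wnullP LF).
have [|||n0 n0P] := @solid_hull_uniform_null _ _ SE A (fun n x => f n (T x)) cA _ _ _ e e0.
- by move=> n; apply: adjoint_linform; exact: (wf.1 n).1.
- move=> v d d0; have [y [y0 yP]] := order_interval_image v.
  have [n0 h] := disjoint_modulus_null du wu y0 d0.
  exists n0 => n nn z zv.
  apply: le_trans (le_trans (ler_norm _) (h n nn)).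
  apply: (ub_le_sup (dabs_has_sup (wf.1 n) y0).2).
  by exists (T z) => //; exact: yP.
- move=> t z ht dz wz; apply/null_seqP; apply: (DP z (f \o t)).
  + exact/banach_disjointP.
  + exact/(banach_wnullP LE).
  + by move=> i j ij; apply: df; exact: increasing_neq.
  + split=> [n|phi pb]; first exact: wf.1.
    exact/null_seqP/(null_seq_comp ht (proj2 (null_seqP _) (wf.2 phi pb))).
exists n0 => n nn; apply: sup_abs_le; first exact: ltW.
by move=> _ [x [a Aa xa] <-]; exact: n0P Aa xa.
Qed.

(** The same theorem on the dual of [F], for evaluation at [T (x n)]; order nullity is
    [disjoint_image_modulus_null]. *)
Lemma almost_weak_DP_adjoint_set (B : set (F -> R)) : almost_weak_DP LE LF T ->
  rel_weakly_compact' B -> almost_L_set LE (adjoint T @` dsol LF B).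
Proof.
move=> DP cB; have Bd := cB.1.
have cB' := rel_weakly_compact'_cluster LF cB.
have [C C0 TC] := operator_bound.
have le f x : is_dual f -> `|f (T x)| <= dnorm f * C * `|x|.
  move=> fd; apply: le_trans (dnorm_bound _ fd) _.
  by rewrite -mulrA; apply: ler_wpM2l; [exact: dnorm_ge0|exact: TC].
have dsolP f : dsol LF B f -> exists (fd : is_dual f) (g : dual_space F),
    B (dval g) /\ rle DF (rabs DF (mk_dual fd)) (rabs DF g).
  move=> [fd [g Bg fg]]; exists fd, (mk_dual (Bd _ Bg)); split=> // x x0.
  by rewrite !dual_rabsE//; exact: fg.
split; [|split].
- move=> _ [f [fd _] <-]; apply/is_dualP; split.
    exact: adjoint_linform fd.1.
  by exists (dnorm f * C) => x; exact: le.
- have [M BM] := weakly_cluster_compact_bounded cB'.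
  exists (M * C) => _ [f /dsolP[fd [g [Bg fg]]] <-]; apply: dnorm_le => x x1.
  apply: le_trans (le _ _ fd) _; rewrite -[leRHS]mulr1; apply: ler_pM => //.
    by apply: mulr_ge0 => //; exact: dnorm_ge0.
  apply: ler_wpM2r => //; apply: le_trans (BM _ Bg); exact: (rnorm_le fg).
move=> x dx wx; apply/null_seqP => e e0.
have [|||n0 n0P] := @solid_hull_uniform_null _ _ DF [set u | B (dval u)]
  (fun n u => dval u (T (x n))) cB' _ _ _ e e0.
- by [].
- move=> v d d0; have [v0|v0] := pselect (rle DF 0 v); last first.
    exists 0%N => n _ z zv; exfalso; apply: v0.
    exact: (rle_trans (r := DF) (rabs_ge0 DF z) zv).
  have [n0 h] := disjoint_image_modulus_null
    (proj2 (banach_disjointP LE x) dx) (proj2 (banach_wnullP LE x) wx) v0 d0.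
  exists n0 => n nn z zv; apply: le_trans (le_trans (ler_norm _) (h n nn)).
  apply: le_trans (dual_abs_le z _) _; apply: zv; exact: (rabs_ge0 SF).
- move=> t z ht dz wz; apply/null_seqP.
  apply: (DP (x \o t) (fun k => dval (z k))).
  + by move=> i j ij; apply: dx; exact: increasing_neq.
  + move=> f fd.
    exact/null_seqP/(null_seq_comp ht (proj2 (null_seqP _) (wx f fd))).
  + by move=> i j ij; apply/dual_disjP; exact: dz.
  + exact/(dual_wnullP LF).
exists n0 => n nn; apply: sup_abs_le; first exact: ltW.
move=> _ [f /dsolP[fd [g [Bg fg]]] <-].
exact: (n0P n nn (mk_dual fd) g Bg fg).
Qed.

(** The hypothesis is applied to the range of [x], and [f n (T (x n))] is one of the values under
    the supremum. *)
Lemma almost_DP_sets_weak_DP :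
  (forall A : set E, rel_weakly_compact A -> almost_DP_set LF (T @` A)) ->
  almost_weak_DP LE LF T.
Proof.
move=> h x f dx wx df wf.
have [bA hA] := h _ (weakly_null_compact wx).
apply/null_seqP => e e0; have /null_seqP/(_ e e0)[n0 n0P] := hA f df wf.
exists n0 => n /n0P; apply: le_trans; apply: le_trans (ler_norm _).
apply: (norm_bounded_sup_ge bA (wf.1 n)); exists (x n) => //.
Qed.

Lemma almost_L_sets_weak_DP :
  (forall B : set (F -> R), rel_weakly_compact' B ->
    almost_L_set LE (adjoint T @` B)) ->
  almost_weak_DP LE LF T.
Proof.
move=> h x f dx wx df wf.
have [dB [bB hB]] := h _ (weakly_null'_compact LF wf).
apply/null_seqP => e e0; have /null_seqP/(_ e e0)[n0 n0P] := hB x dx wx.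
exists n0 => n /n0P; apply: le_trans; apply: le_trans (ler_norm _).
apply: (norm_bounded'_sup_ge (x n) dB bB (g := adjoint T (f n))).
by exists (f n) => //; exists n.
Qed.

End OrderBoundedOperator.

Theorem theorem2p3 (R : realType) (E F : completeNormedModType R)
  (LE : BanachLattice E) (LF : BanachLattice F)
  (T : {linear E -> F}) (Tcont : continuous T)
  (Tob : order_bounded LE LF T) :
  [<-> almost_weak_DP LE LF T;
       forall A : set E, rel_weakly_compact A -> almost_DP_set LF (T @` sol LE A);
       forall A : set E, rel_weakly_compact A -> almost_DP_set LF (T @` A);
       forall B : set (F -> R), rel_weakly_compact' B ->
         almost_L_set LE (adjoint T @` dsol LF B);
       forall B : set (F -> R), rel_weakly_compact' B ->
         almost_L_set LE (adjoint T @` B)].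
Proof.
tfae.
- by move=> DP A; exact: almost_weak_DP_set.
- move=> h A /h; apply: almost_DP_set_sub; apply: image_subset => a Aa.
  by exists a => //; exact: ble_refl.
(* The passage from [E] to the dual of [F] goes through the first statement. *)
- by move=> /almost_DP_sets_weak_DP DP B; exact: almost_weak_DP_adjoint_set.
- move=> h B cB; apply: almost_L_set_sub (h B cB); apply: image_subset => g Bg.
  by split; [exact: cB.1|exists g].
- exact: almost_L_sets_weak_DP.
Qed.
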